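(* Every internal bicategory in the category $\mathsf{Grp}$ of groups satisfying $1_a\otimes 1_a=1_a$ (see context) is completely determined, up to isomorphism, by data consisting of groups $X$ (written additively, not necessarily abelian) and $B$ (written multiplicatively), group homomorphisms $h\colon X\to B$ and $s,t,\lambda,\rho\colon X\to X$, and a map of sets $\xi\colon B\times X\to X$, $\xi(b,x)=b\cdot x$, satisfying: (i) $\xi$ is an action of $B$ on $X$ by group homomorphisms: $1\cdot x=x$, $(bb')\cdot x=b\cdot(b'\cdot x)$, $b\cdot(x+y)=b\cdot x+b\cdot y$; (ii) $h(b\cdot x)=b\,h(x)\,b^{-1}$; (iii) $st=t$ and $ts=s$; (iv) $hs=h=ht$; (v) $h\lambda=h=h\rho$; (vi) $\lambda(x)-\lambda s(x)+t\lambda s(x)=x=\rho(x)-\rho s(x)+t\rho s(x)$ for all $x\in X$; (vii) $[\ker(s),\ker(t)]=0$, i.e. every element of $\ker(s)$ commutes with every element of $\ker(t)$; (viii) the maps $m\colon X^2\times B\to X\times B$ and $\alpha\colon X^3\times B\to X\times B$ defined by $$m(x,x',b)=(u(x)+v(x'),b),\qquad \alpha(x,x',x'',b)=(\alpha_1(x)+\alpha_2(x')+\alpha_3(x''),b),$$ where (pointwise, in the written order) $$u=s\rho t-\rho t+\rho,\qquad v=s\lambda t-\lambda t+\lambda,$$ $$\alpha_1=s\rho\rho t-\rho s\rho t+s\rho t-\rho t+\rho,$$ $$\alpha_2=s\rho\lambda-\rho s\lambda t+s\rho t-\rho t+\rho,$$ $$\alpha_3=\lambda s\lambda t-\lambda\lambda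 t+\lambda\lambda,$$ are group homomorphisms $$X\rtimes_{\xi_1}(X\rtimes_\xi B)\xrightarrow{\ m\ }X\rtimes_\xi B\xleftarrow{\ \alpha\ }X\rtimes_{\xi_2}(X\rtimes_{\xi_1}(X\rtimes_\xi B)),$$ where $\xi_1((x',b),x)=(h(x')b)\cdot x$ and $\xi_2((x',x'',b),x)=(h(x'+x'')b)\cdot x$. The way the internal bicategory is recovered, up to isomorphism, from the data is described in the context.
   Context: **Pseudocategories.** A pseudocategory in a 2-category consists of objects $C_0,C_1$, morphisms $d,c\colon C_1\to C_0$, $e\colon C_0\to C_1$ with $de=1=ce$, a morphism $m\colon C_2=C_1\times_{C_0}C_1\to C_1$ on the pullback of $d$ (first factor, projection $\pi_1$) and $c$ (second factor, projection $\pi_2$), with $dm=d\pi_2$, $cm=c\pi_1$, and invertible 2-cells $\alpha\colon m(1\times m)\Rightarrow m(m\times 1)$, $\lambda\colon me_2\Rightarrow 1_{C_1}$, $\rho\colon me_1\Rightarrow 1_{C_1}$, where $e_1=\langle 1,ed\rangle$, $e_2=\langle ec,1\rangle$, satisfying $d\lambda=d=d\rho$, $c\lambda=c=c\rho$, $d\alpha=d\pi_3$, $c\alpha=c\pi_1$, $\lambda e=\rho e$, and the usual coherence conditions of a bicategory: the pentagon $\alpha(m\times1\times1)\cdot\alpha(1\times1\times m)=m(\alpha\times1)\cdot\alpha(1\times m\times1)\cdot m(1\times\alpha)$ and the triangle $m(\rho\times1)\cdot\alpha\langle\pi_1,ed\pi_1,\pi_2\rangle=m(1\times\lambda)$. **Internal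 bicategories.** An internal bicategory in $\mathsf{Grp}$ is a pseudocategory in the 2-category $\mathsf{Cat}(\mathsf{Grp})$ of internal categories, internal functors and internal natural transformations in $\mathsf{Grp}$, such that $C_0$ is a discrete internal category. The condition $1_a\otimes1_a=1_a$ means $\lambda e=e=\rho e$ (the 2-cells $\lambda e,\rho e$ are the identity 2-cell on $e$). **The structure recovered from the data.** $X\rtimes_\xi B$ has underlying set $X\times B$ and product $(x,b)(x',b')=(x+b\cdot x',bb')$; other semidirect products are analogous. - $C_0$ is the discrete internal category on $B$. - $C_1$ is the internal category whose group of arrows (the 2-cells of the bicategory) is $X\rtimes_\xi B$. The identity arrow on the source of $(x,b)$ is $(s(x),b)$ and the identity arrow on its target is $(t(x),b)$; so the objects of $C_1$ (the morphisms of the bicategory) are the elements $(x,b)$ with $s(x)=x$. Vertical composition is $(x',b)\circ(x,b)=(x'-s(x')+x,b)$ when $s(x')=t(x)$. - $d(x,b)=b$, $c(x,b)=h(x)b$, $e(b)=(0,b)$. - The pair $((x,h(x')b),(x',b))\in C_1\times_{C_0}C_1$ is identified with $(x,x',b)$, and horizontal composition is $m(x,x',b)=(u(x)+v(x'),b)$; triples of composable elements are similarly identified with $(x,x',x'',b)$. - The components of the natural isomorphisms $\lambda$, $\rho$ at an object $(x,b)$ of $C_1$ are $(\lambda(x),b)$ and $(\rho(x),b)$, and the component of the associativity isomorphism at a composable triple of objects $(x,x',x'',b)$ is $\alpha(x,x',x'',b)$.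
   Formalization: The printed formula for α₂ is false (take C₁ codiscrete on a nonabelian group, B trivial, m(x,x')=x'); it is replaced by α₂ = sρλt − ρsλt + sλt − λt + λρ. *)

(* Defs.v *)
From HB Require Import structures.
From mathcomp Require Import all_boot.

Set Implicit Arguments.
Unset Strict Implicit.
Unset Printing Implicit Defensive.

Local Open Scope group_scope.

(* Groups are MathComp's [groupType]s (no finiteness), written multiplicatively
   throughout, including the group X below that is usually written additively:
   x + y becomes x * y, -x becomes x^-1 and 0 becomes 1. *)

Notation "{ 'hom' G -> H }" := (UMagmaMorphism.type G H)
  (G at level 98, H at level 99, format "{ 'hom'  G  ->  H }") : type_scope.

Definition compG (G H K : groupType) (f : {hom H -> K})
  (g : {hom G -> H}) : {hom G -> K} := f \o g.

Definition idG (G : groupType) : {hom G -> G} := idfun.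

Section PullbackGroup.
Variables (A B C : groupType).
Variables (f : {hom A -> C}) (g : {hom B -> C}).

Definition pb_pred : pred (A * B) := fun p => f p.1 == g p.2.

Record pb := Pb { pb_val :> A * B; pb_prop : pb_pred pb_val }.

HB.instance Definition _ := [isSub for pb_val].
HB.instance Definition _ := [Choice of pb by <:].

Fact pb_closed : group_closed pb_pred.
Proof.
split; first by apply/eqP; rewrite -[LHS]/(f 1) -[RHS]/(g 1) !gmulf1.
move=> x y /eqP ex /eqP ey; apply/eqP.
by rewrite -[LHS]/(f (x.1 / y.1)) -[RHS]/(g (x.2 / y.2)) !gmulfF ex ey.
Qed.

HB.instance Definition _ := SubChoice_isSubGroup.Build (A * B)%type pb_pred pb pb_closed.

Definition pr1 : {hom pb -> A} := fst \o (val : pb -> A * B).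
Definition pr2 : {hom pb -> B} := snd \o (val : pb -> A * B).

Lemma pbP (p : pb) : f (pr1 p) = g (pr2 p).
Proof. exact/eqP/(pb_prop p). Qed.

Definition pbk (a : A) (b : B) (e : f a = g b) : pb :=
  @Pb (a, b) (introT eqP e).

Lemma pb_eq (p q : pb) : pr1 p = pr1 q -> pr2 p = pr2 q -> p = q.
Proof.
case: p q => [[p1 p2] pP] [[q1 q2] qP]; rewrite /pr1 /pr2 /=.
by move=> e1 e2; apply: val_inj; rewrite /= e1 e2.
Qed.

Variables (D : groupType) (a : {hom D -> A}).
Variables (b : {hom D -> B}) (e : forall x, f (a x) = g (b x)).

Definition pairG_fun (x : D) : pb := pbk (e x).

Fact pairG_morph : {morph pairG_fun : x y / x / y}.
Proof.
by move=> x y; apply: pb_eq; rewrite /= gmulfF.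
Qed.

HB.instance Definition _ := isGroupMorphism.Build D pb pairG_fun pairG_morph.

Definition pairG : {hom D -> pb} := pairG_fun.

End PullbackGroup.

Arguments pr1 {A B C f g}.
Arguments pr2 {A B C f g}.
Arguments pbk {A B C f g} a b e.

(* [cmp] is defined on pairs (g, f) with src g = tgt f: it is "g after f". *)
Record intCat := IntCat {
  ob : groupType;
  ar : groupType;
  src : {hom ar -> ob};
  tgt : {hom ar -> ob};
  idn : {hom ob -> ar};
  cmp : {hom pb src tgt -> ar};
  src_idn : forall a, src (idn a) = a;
  tgt_idn : forall a, tgt (idn a) = a;
  src_cmp : forall p, src (cmp p) = src (pr2 p);
  tgt_cmp : forall p, tgt (cmp p) = tgt (pr1 p);
  cmp1f : forall f, cmp (pbk (idn (tgt f)) f (src_idn (tgt f))) = f;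
  cmpf1 : forall f, cmp (pbk f (idn (src f)) (esym (tgt_idn (src f)))) = f;
  cmpA : forall h g f (e1 : src h = tgt g) (e2 : src g = tgt f),
    cmp (pbk h (cmp (pbk g f e2)) (etrans e1 (esym (tgt_cmp (pbk g f e2))))) =
    cmp (pbk (cmp (pbk h g e1)) f (etrans (src_cmp (pbk h g e1)) e2))
}.

Definition discrete (A : intCat) : Prop := forall f : ar A, f = idn A (src A f).

Arguments src {i}.
Arguments tgt {i}.
Arguments idn {i}.
Arguments cmp {i}.

Lemma cmp_eq (A : intCat) (g g' f f' : ar A) e e' :
  g = g' -> f = f' -> cmp (pbk g f e) = cmp (pbk g' f' e').
Proof. by move=> eg ef; congr (cmp _); apply: pb_eq. Qed.

Record functor (A B : intCat) := Functor {
  fob : {hom ob A -> ob B};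
  far : {hom ar A -> ar B};
  src_far : forall f, src (far f) = fob (src f);
  tgt_far : forall f, tgt (far f) = fob (tgt f);
  far_idn : forall a, far (idn a) = idn (fob a);
  far_cmp : forall p : pb (@src A) tgt,
    far (cmp p) = cmp (pbk (far (pr1 p)) (far (pr2 p))
      (etrans (src_far (pr1 p))
        (etrans (congr1 fob (pbP p)) (esym (tgt_far (pr2 p))))))
}.

Definition eqF (A B : intCat) (F G : functor A B) : Prop :=
  (fob F =1 fob G) /\ (far F =1 far G).

Notation "F ≡ G" := (eqF F G) (at level 70, no associativity).

Lemma eqF_refl (A B : intCat) (F : functor A B) : F ≡ F.
Proof. by []. Qed.

Record natTrans (A B : intCat) (F G : functor A B) := Nat {
  nt :> {hom ob A -> ar B};
  src_nt : forall a, src (nt a) = fob F a;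
  tgt_nt : forall a, tgt (nt a) = fob G a;
  natural : forall f : ar A,
    cmp (pbk (nt (tgt f)) (far F f)
      (etrans (src_nt (tgt f)) (esym (tgt_far F f)))) =
    cmp (pbk (far G f) (nt (src f))
      (etrans (src_far G f) (esym (tgt_nt (src f)))))
}.

Notation "F ⇒ G" := (natTrans F G) (at level 70, no associativity).

(* Equality of 2-cells whose (co)domains agree only up to [eqF]. *)
Definition eq2 (A B : intCat) (F G F' G' : functor A B)
  (s : F ⇒ G) (s' : F' ⇒ G') : Prop := forall a, s a = s' a.

Notation "s ≡₂ s'" := (eq2 s s') (at level 70, no associativity).

Definition idF (A : intCat) : functor A A.
Proof.
refine (@Functor A A (idG (ob A)) (idG (ar A)) (fun=> erefl) (fun=> erefl) _ _).
- by [].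
- by move=> p; congr (cmp _); apply: pb_eq.
Defined.

Section CompositeFunctor.
Variables (A B C : intCat) (G : functor B C) (F : functor A B).

Definition compF_ob : {hom ob A -> ob C} := compG (fob G) (fob F).
Definition compF_ar : {hom ar A -> ar C} := compG (far G) (far F).

Fact compF_src f : src (compF_ar f) = compF_ob (src f).
Proof. by rewrite /= src_far src_far. Qed.

Fact compF_tgt f : tgt (compF_ar f) = compF_ob (tgt f).
Proof. by rewrite /= tgt_far tgt_far. Qed.

Fact compF_idn a : compF_ar (idn a) = idn (compF_ob a).
Proof. by rewrite /= !far_idn. Qed.

Fact compF_cmp (p : pb (@src A) tgt) e :
  compF_ar (cmp p) = cmp (pbk (compF_ar (pr1 p)) (compF_ar (pr2 p)) e).
Proof. by rewrite /= !far_cmp; apply: cmp_eq. Qed.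

Definition compF : functor A C :=
  Functor (src_far := compF_src) (tgt_far := compF_tgt) compF_idn
    (fun p => compF_cmp _).

End CompositeFunctor.

Notation "G ∘ F" := (compF G F) (at level 40, left associativity).

Section TwoCells.
Variables (A B : intCat).

Lemma naturalE (F G : functor A B) (s : F ⇒ G) f e1 e2 :
  cmp (pbk (s (tgt f)) (far F f) e1) = cmp (pbk (far G f) (s (src f)) e2).
Proof.
by etransitivity; [etransitivity; [|exact: (natural s f)]|]; apply: cmp_eq.
Qed.

Section Identity.
Variable F : functor A B.

Fact id2_natural f e1 e2 :
  cmp (pbk (idn (fob F (tgt f))) (far F f) e1) =
  cmp (pbk (far F f) (idn (fob F (src f))) e2).
Proof.
transitivity (far F f).
- by rewrite -[RHS]cmp1f; apply: cmp_eq; rewrite // tgt_far.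
- by rewrite -[LHS]cmpf1; apply: cmp_eq; rewrite // src_far.
Qed.

Definition id2 : F ⇒ F :=
  @Nat A B F F (compG idn (fob F)) (fun a => src_idn (fob F a))
    (fun a => tgt_idn (fob F a)) (fun f => id2_natural _ _).

End Identity.

Section Vertical.
Variables (F G G' H : functor A B) (s' : G' ⇒ H) (s : F ⇒ G) (e : G ≡ G').

Fact vcomp_composable a : src (s' a) = tgt (s a).
Proof. by rewrite src_nt tgt_nt e.1. Qed.

Definition vcomp_nt : {hom ob A -> ar B} := compG cmp (pairG vcomp_composable).

Fact vcomp_src a : src (vcomp_nt a) = fob F a.
Proof. by rewrite /= src_cmp src_nt. Qed.

Fact vcomp_tgt a : tgt (vcomp_nt a) = fob H a.
Proof. by rewrite /= tgt_cmp tgt_nt. Qed.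

Fact vcomp_natural f e1 e2 :
  cmp (pbk (vcomp_nt (tgt f)) (far F f) e1) =
  cmp (pbk (far H f) (vcomp_nt (src f)) e2).
Proof.
have c1 : src (s' (tgt f)) = tgt (far G f) by rewrite src_nt tgt_far e.1.
have c2 : src (s (tgt f)) = tgt (far F f) by rewrite src_nt tgt_far.
have c3 : src (far G f) = tgt (s (src f)) by rewrite src_far tgt_nt.
have c4 : src (far H f) = tgt (s' (src f)) by rewrite src_far tgt_nt.
have c1' : src (s' (tgt f)) = tgt (far G' f) by rewrite -e.2.
have c5 := vcomp_composable.
apply: (etrans _ (etrans (esym (cmpA (c5 (tgt f)) c2)) _)).
  by do 2?apply: cmp_eq.
apply: (etrans _ (etrans (cmpA c1 c3) _)).
  by apply: cmp_eq; rewrite // (naturalE c2 c3).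
apply: (etrans _ (etrans (esym (cmpA c4 (c5 (src f)))) _)); last first.
  by do 2?apply: cmp_eq.
apply: cmp_eq => //; rewrite -(naturalE c1' c4).
by apply: cmp_eq; rewrite // e.2.
Qed.

Definition vcomp : F ⇒ H :=
  Nat (src_nt := vcomp_src) (tgt_nt := vcomp_tgt) (fun f => vcomp_natural _ _).

End Vertical.

End TwoCells.

Arguments vcomp {A B F G G' H} s' s e.

Section WhiskerL.
Variables (A B C : intCat) (H : functor B C) (F G : functor A B) (s : F ⇒ G).

Definition whiskL_nt : {hom ob A -> ar C} := compG (far H) s.

Fact whiskL_src a : src (whiskL_nt a) = fob (H ∘ F) a.
Proof. by rewrite /= src_far src_nt. Qed.

Fact whiskL_tgt a : tgt (whiskL_nt a) = fob (H ∘ G) a.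
Proof. by rewrite /= tgt_far tgt_nt. Qed.

Fact whiskL_natural f e1 e2 :
  cmp (pbk (whiskL_nt (tgt f)) (far (H ∘ F) f) e1) =
  cmp (pbk (far (H ∘ G) f) (whiskL_nt (src f)) e2).
Proof.
have /(congr1 (far H)) := natural s f; rewrite !far_cmp => e.
by etransitivity; [etransitivity; [|exact: e]|]; apply: cmp_eq.
Qed.

Definition whiskL : H ∘ F ⇒ H ∘ G :=
  Nat (src_nt := whiskL_src) (tgt_nt := whiskL_tgt) (fun f => whiskL_natural _ _).

End WhiskerL.

Section WhiskerR.
Variables (A B C : intCat) (F G : functor B C) (s : F ⇒ G) (K : functor A B).

Definition whiskR_nt : {hom ob A -> ar C} := compG s (fob K).

Fact whiskR_natural f e1 e2 :
  cmp (pbk (whiskR_nt (tgt f)) (far (F ∘ K) f) e1) =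
  cmp (pbk (far (G ∘ K) f) (whiskR_nt (src f)) e2).
Proof.
have e := natural s (far K f).
by etransitivity; [etransitivity; [|exact: e]|]; apply: cmp_eq;
  rewrite //= (tgt_far, src_far).
Qed.

Definition whiskR : F ∘ K ⇒ G ∘ K :=
  @Nat A C (F ∘ K) (G ∘ K) whiskR_nt
    (fun a => src_nt s (fob K a)) (fun a => tgt_nt s (fob K a))
    (fun f => whiskR_natural _ _).

End WhiskerR.

Definition invertible (A B : intCat) (F G : functor A B) (s : F ⇒ G) : Prop :=
  exists s' : G ⇒ F,
    vcomp s' s (eqF_refl G) ≡₂ id2 F /\ vcomp s s' (eqF_refl F) ≡₂ id2 G.

Section PullbackCat.
Variables (A B C : intCat) (F : functor A C) (G : functor B C).

Definition pbC_ob : groupType := pb (fob F) (fob G).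
Definition pbC_ar : groupType := pb (far F) (far G).

Fact pbC_src_eq (p : pbC_ar) : fob F (src (pr1 p)) = fob G (src (pr2 p)).
Proof. by rewrite -!src_far pbP. Qed.

Fact pbC_tgt_eq (p : pbC_ar) : fob F (tgt (pr1 p)) = fob G (tgt (pr2 p)).
Proof. by rewrite -!tgt_far pbP. Qed.

Fact pbC_idn_eq (a : pbC_ob) : far F (idn (pr1 a)) = far G (idn (pr2 a)).
Proof. by rewrite !far_idn pbP. Qed.

Definition pbC_src : {hom pbC_ar -> pbC_ob} :=
  pairG (a := compG src pr1) (b := compG src pr2) pbC_src_eq.
Definition pbC_tgt : {hom pbC_ar -> pbC_ob} :=
  pairG (a := compG tgt pr1) (b := compG tgt pr2) pbC_tgt_eq.
Definition pbC_idn : {hom pbC_ob -> pbC_ar} :=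
  pairG (a := compG idn pr1) (b := compG idn pr2) pbC_idn_eq.

Fact pbC_comp1 (q : pb pbC_src pbC_tgt) :
  src (pr1 (pr1 q)) = tgt (pr1 (pr2 q)).
Proof. by have /(congr1 pr1) := pbP q. Qed.

Fact pbC_comp2 (q : pb pbC_src pbC_tgt) :
  src (pr2 (pr1 q)) = tgt (pr2 (pr2 q)).
Proof. by have /(congr1 pr2) := pbP q. Qed.

Definition pbC_cmp1 : {hom pb pbC_src pbC_tgt -> ar A} :=
  compG cmp (pairG (a := compG pr1 pr1) (b := compG pr1 pr2) pbC_comp1).
Definition pbC_cmp2 : {hom pb pbC_src pbC_tgt -> ar B} :=
  compG cmp (pairG (a := compG pr2 pr1) (b := compG pr2 pr2) pbC_comp2).

Fact pbC_cmp_eq q : far F (pbC_cmp1 q) = far G (pbC_cmp2 q).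
Proof. by rewrite /= !far_cmp; apply: cmp_eq; exact: pbP. Qed.

Definition pbC_cmp : {hom pb pbC_src pbC_tgt -> pbC_ar} := pairG pbC_cmp_eq.

Fact pbC_src_idn a : pbC_src (pbC_idn a) = a.
Proof.
by apply: pb_eq; [exact: src_idn (pr1 a)|exact: src_idn (pr2 a)].
Qed.

Fact pbC_tgt_idn a : pbC_tgt (pbC_idn a) = a.
Proof.
by apply: pb_eq; [exact: tgt_idn (pr1 a)|exact: tgt_idn (pr2 a)].
Qed.

Fact pbC_src_cmp p : pbC_src (pbC_cmp p) = pbC_src (pr2 p).
Proof. by apply: pb_eq => /=; rewrite src_cmp. Qed.

Fact pbC_tgt_cmp p : pbC_tgt (pbC_cmp p) = pbC_tgt (pr1 p).
Proof. by apply: pb_eq => /=; rewrite tgt_cmp. Qed.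

Fact pbC_cmp1f f e : pbC_cmp (pbk (pbC_idn (pbC_tgt f)) f e) = f.
Proof.
apply: pb_eq.
- by rewrite -[RHS](cmp1f (pr1 f)); apply: cmp_eq.
- by rewrite -[RHS](cmp1f (pr2 f)); apply: cmp_eq.
Qed.

Fact pbC_cmpf1 f e : pbC_cmp (pbk f (pbC_idn (pbC_src f)) e) = f.
Proof.
apply: pb_eq.
- by rewrite -[RHS](cmpf1 (pr1 f)); apply: cmp_eq.
- by rewrite -[RHS](cmpf1 (pr2 f)); apply: cmp_eq.
Qed.

Fact pbC_cmpA h g f e1 e2 e3 e4 :
  pbC_cmp (pbk h (pbC_cmp (pbk g f e2)) e3) =
  pbC_cmp (pbk (pbC_cmp (pbk h g e1)) f e4).
Proof.
apply: pb_eq.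
- have d1 : src (pr1 h) = tgt (pr1 g) by have /(congr1 pr1) := e1.
  have d2 : src (pr1 g) = tgt (pr1 f) by have /(congr1 pr1) := e2.
  by apply: (etrans _ (etrans (cmpA d1 d2) _)); do 2?apply: cmp_eq.
- have d1 : src (pr2 h) = tgt (pr2 g) by have /(congr1 pr2) := e1.
  have d2 : src (pr2 g) = tgt (pr2 f) by have /(congr1 pr2) := e2.
  by apply: (etrans _ (etrans (cmpA d1 d2) _)); do 2?apply: cmp_eq.
Qed.

Definition pbC : intCat :=
  IntCat (src_idn := pbC_src_idn) (tgt_idn := pbC_tgt_idn)
    (src_cmp := pbC_src_cmp) (tgt_cmp := pbC_tgt_cmp)
    (fun f => pbC_cmp1f _) (fun f => pbC_cmpf1 _)
    (fun h g f e1 e2 => pbC_cmpA _ _).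

Fact p1_cmp (p : pb (@src pbC) tgt) e :
  pr1 (cmp p) = cmp (pbk (pr1 (pr1 p)) (pr1 (pr2 p)) e).
Proof. exact: cmp_eq. Qed.

Fact p2_cmp (p : pb (@src pbC) tgt) e :
  pr2 (cmp p) = cmp (pbk (pr2 (pr1 p)) (pr2 (pr2 p)) e).
Proof. exact: cmp_eq. Qed.

Definition p1 : functor pbC A :=
  @Functor pbC A pr1 pr1 (fun=> erefl) (fun=> erefl) (fun=> erefl)
    (fun p => p1_cmp _).

Definition p2 : functor pbC B :=
  @Functor pbC B pr2 pr2 (fun=> erefl) (fun=> erefl) (fun=> erefl)
    (fun p => p2_cmp _).

Lemma pbC_square : F ∘ p1 ≡ G ∘ p2.
Proof. by split=> p; exact: pbP. Qed.

Section Pairing.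
Variable D : intCat.

Section Functors.
Variables (H : functor D A) (K : functor D B) (e : F ∘ H ≡ G ∘ K).

Definition pairF_ob : {hom ob D -> ob pbC} := pairG e.1.
Definition pairF_ar : {hom ar D -> ar pbC} := pairG e.2.

Fact pairF_src f : src (pairF_ar f) = pairF_ob (src f).
Proof. by apply: pb_eq; exact: src_far. Qed.

Fact pairF_tgt f : tgt (pairF_ar f) = pairF_ob (tgt f).
Proof. by apply: pb_eq; exact: tgt_far. Qed.

Fact pairF_idn a : pairF_ar (idn a) = idn (pairF_ob a).
Proof. by apply: pb_eq; exact: far_idn. Qed.

Fact pairF_cmp (p : pb (@src D) tgt) e' :
  pairF_ar (cmp p) = cmp (pbk (pairF_ar (pr1 p)) (pairF_ar (pr2 p)) e').
Proof. by apply: pb_eq => /=; rewrite far_cmp; apply: cmp_eq. Qed.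

Definition pairF : functor D pbC :=
  Functor (src_far := pairF_src) (tgt_far := pairF_tgt) pairF_idn
    (fun p => pairF_cmp _).

End Functors.

Variables (H H' : functor D A) (K K' : functor D B).
Variables (e : F ∘ H ≡ G ∘ K) (e' : F ∘ H' ≡ G ∘ K').
Variables (s : H ⇒ H') (t : K ⇒ K') (est : whiskL F s ≡₂ whiskL G t).

Definition pair2_nt : {hom ob D -> ar pbC} := pairG est.

Fact pair2_src a : src (pair2_nt a) = fob (pairF e) a.
Proof. by apply: pb_eq; exact: src_nt. Qed.

Fact pair2_tgt a : tgt (pair2_nt a) = fob (pairF e') a.
Proof. by apply: pb_eq; exact: tgt_nt. Qed.

Fact pair2_natural f e1 e2 :
  cmp (pbk (pair2_nt (tgt f)) (far (pairF e) f) e1) =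
  cmp (pbk (far (pairF e') f) (pair2_nt (src f)) e2).
Proof. by apply: pb_eq; exact: naturalE. Qed.

Definition pair2 : pairF e ⇒ pairF e' :=
  Nat (src_nt := pair2_src) (tgt_nt := pair2_tgt) (fun f => pair2_natural _ _).

End Pairing.

End PullbackCat.

Arguments pbC {A B C} F G.
Arguments p1 {A B C F G}.
Arguments p2 {A B C F G}.
Arguments pairF {A B C F G D} H K e.
Arguments pair2 {A B C F G D H H' K K'} e e' s t est.

Record preCat := PreCat {
  C0 : intCat;
  C1 : intCat;
  dF : functor C1 C0;
  cF : functor C1 C0;
  eF : functor C0 C1;
  mF : functor (pbC dF cF) C1;
  dF_eF : dF ∘ eF ≡ idF C0;
  cF_eF : cF ∘ eF ≡ idF C0;
  dF_mF : dF ∘ mF ≡ dF ∘ p2;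
  cF_mF : cF ∘ mF ≡ cF ∘ p1
}.

Arguments dF {p}.
Arguments cF {p}.
Arguments eF {p}.
Arguments mF {p}.

Section Shapes.
Variable P : preCat.
Local Notation C1 := (C1 P).

Lemma dF_eF_ob x : fob dF (fob (@eF P) x) = x.
Proof. exact: (dF_eF P).1. Qed.
Lemma dF_eF_ar x : far dF (far (@eF P) x) = x.
Proof. exact: (dF_eF P).2. Qed.
Lemma cF_eF_ob x : fob cF (fob (@eF P) x) = x.
Proof. exact: (cF_eF P).1. Qed.
Lemma cF_eF_ar x : far cF (far (@eF P) x) = x.
Proof. exact: (cF_eF P).2. Qed.
Lemma dF_mF_ob x : fob dF (fob (@mF P) x) = fob dF (pr2 x).
Proof. exact: (dF_mF P).1. Qed.
Lemma dF_mF_ar x : far dF (far (@mF P) x) = far dF (pr2 x).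
Proof. exact: (dF_mF P).2. Qed.
Lemma cF_mF_ob x : fob cF (fob (@mF P) x) = fob cF (pr1 x).
Proof. exact: (cF_mF P).1. Qed.
Lemma cF_mF_ar x : far cF (far (@mF P) x) = far cF (pr1 x).
Proof. exact: (cF_mF P).2. Qed.

(* Composable pairs, triples and quadruples, as (f, g), (f, (g, h)) and
   (f, (g, (h, k))), with their projections. *)
Definition C2 : intCat := pbC (@dF P) cF.
Definition s1 : functor C2 C1 := p1.
Definition s2 : functor C2 C1 := p2.

Definition C3 : intCat := pbC (@dF P) (cF ∘ s1).
Definition t1 : functor C3 C1 := p1.
Definition t23 : functor C3 C2 := p2.
Definition t2 : functor C3 C1 := s1 ∘ t23.
Definition t3 : functor C3 C1 := s2 ∘ t23.

Definition C4 : intCat := pbC (@dF P) (cF ∘ t1).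
Definition q1 : functor C4 C1 := p1.
Definition q234 : functor C4 C3 := p2.
Definition q2 : functor C4 C1 := t1 ∘ q234.
Definition q3 : functor C4 C1 := t2 ∘ q234.
Definition q4 : functor C4 C1 := t3 ∘ q234.
Definition q34 : functor C4 C2 := t23 ∘ q234.

(* e1 = <1, ed>, e2 = <ec, 1> *)
Fact e1_eq : dF ∘ idF C1 ≡ cF ∘ (eF ∘ dF).
Proof. by split=> x /=; rewrite (cF_eF_ob, cF_eF_ar). Qed.
Definition e1 : functor C1 C2 := pairF (idF C1) (eF ∘ dF) e1_eq.

Fact e2_eq : dF ∘ (eF ∘ cF) ≡ cF ∘ idF C1.
Proof. by split=> x /=; rewrite (dF_eF_ob, dF_eF_ar). Qed.
Definition e2 : functor C1 C2 := pairF (eF ∘ cF) (idF C1) e2_eq.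

(* (f, g, h) |-> (f, g) *)
Fact t12_eq : dF ∘ t1 ≡ cF ∘ t2.
Proof. by split=> x; exact: pbP x. Qed.
Definition t12 : functor C3 C2 := pairF t1 t2 t12_eq.

(* (f, g, h) |-> (f, m(g, h)) and (f, g, h) |-> (m(f, g), h) *)
Fact one_m_eq : dF ∘ t1 ≡ cF ∘ (mF ∘ t23).
Proof.
by split=> x /=; rewrite (cF_mF_ob, cF_mF_ar); exact: pbP x.
Qed.
Definition one_m : functor C3 C2 := pairF t1 (mF ∘ t23) one_m_eq.

Fact m_one_eq : dF ∘ (mF ∘ t12) ≡ cF ∘ t3.
Proof.
split=> x; [apply: (etrans (dF_mF_ob (fob t12 x)))
  |apply: (etrans (dF_mF_ar (far t12 x)))].
all: exact: (pbP (pr2 x)).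
Qed.
Definition m_one : functor C3 C2 := pairF (mF ∘ t12) t3 m_one_eq.

(* (f, g) |-> (f, e(d(f)), g) *)
Fact unit_pair_eq : dF ∘ (eF ∘ dF ∘ s1) ≡ cF ∘ s2.
Proof.
by split=> x /=; rewrite (dF_eF_ob, dF_eF_ar); exact: pbP x.
Qed.
Fact unit_mid_eq :
  dF ∘ s1 ≡ cF ∘ s1 ∘ pairF (eF ∘ dF ∘ s1) s2 unit_pair_eq.
Proof. by split=> x /=; rewrite (cF_eF_ob, cF_eF_ar). Qed.
Definition unit_mid : functor C2 C3 :=
  pairF s1 (pairF (eF ∘ dF ∘ s1) s2 unit_pair_eq) unit_mid_eq.

(* (f, g, h, k) |-> (f, g, h) *)
Fact q23_eq : dF ∘ q2 ≡ cF ∘ q3.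
Proof. by split=> x; exact: pbP (pr2 x). Qed.
Fact q123_eq : dF ∘ q1 ≡ cF ∘ s1 ∘ pairF q2 q3 q23_eq.
Proof. by split=> x; exact: pbP x. Qed.
Definition q123 : functor C4 C3 := pairF q1 (pairF q2 q3 q23_eq) q123_eq.

(* (f, g, h, k) |-> (f, g, m(h, k)) *)
Fact one_one_m_eq : dF ∘ q1 ≡ cF ∘ s1 ∘ (one_m ∘ q234).
Proof. by split=> x; exact: pbP x. Qed.
Definition one_one_m : functor C4 C3 := pairF q1 (one_m ∘ q234) one_one_m_eq.

(* (f, g, h, k) |-> (f, m(g, h), k) *)
Fact one_m_one_eq : dF ∘ q1 ≡ cF ∘ s1 ∘ (m_one ∘ q234).
Proof.
by split=> x /=; rewrite (cF_mF_ob, cF_mF_ar); exact: pbP x.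
Qed.
Definition one_m_one : functor C4 C3 := pairF q1 (m_one ∘ q234) one_m_one_eq.

(* (f, g, h, k) |-> (m(f, g), h, k) *)
Fact m_one_one_eq : dF ∘ (mF ∘ (t12 ∘ q123)) ≡ cF ∘ s1 ∘ q34.
Proof.
split=> x; [apply: (etrans (dF_mF_ob (fob (t12 ∘ q123) x)))
  |apply: (etrans (dF_mF_ar (far (t12 ∘ q123) x)))].
all: exact: (pbP (pr2 x)).
Qed.
Definition m_one_one : functor C4 C3 :=
  pairF (mF ∘ (t12 ∘ q123)) q34 m_one_one_eq.

End Shapes.

Section Coherence.
Variable P : preCat.
Local Notation C1 := (C1 P).
Variable alpha : mF ∘ one_m P ⇒ mF ∘ m_one P.
Variable lam : mF ∘ e2 P ⇒ idF C1.
Variable rho : mF ∘ e1 P ⇒ idF C1.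
Hypothesis d_alpha : whiskL dF alpha ≡₂ id2 (dF ∘ t3 P).
Hypothesis c_alpha : whiskL cF alpha ≡₂ id2 (cF ∘ t1 P).
Hypothesis d_rho : whiskL dF rho ≡₂ id2 dF.
Hypothesis c_lam : whiskL cF lam ≡₂ id2 cF.

(* alpha x 1 : (m(1 x m)) x 1 ⇒ (m(m x 1)) x 1 and
   1 x alpha : 1 x (m(1 x m)) ⇒ 1 x (m(m x 1)), 2-cells between functors
   from C4 to C2. *)
Fact alpha_one_src :
  dF ∘ (mF ∘ one_m P ∘ q123 P) ≡ cF ∘ q4 P.
Proof.
split=> x; [apply: (etrans (dF_mF_ob _)); apply: (etrans (dF_mF_ob _))
  |apply: (etrans (dF_mF_ar _)); apply: (etrans (dF_mF_ar _))].
all: exact: (pbP (pr2 (pr2 x))).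
Qed.
Fact alpha_one_tgt :
  dF ∘ (mF ∘ m_one P ∘ q123 P) ≡ cF ∘ q4 P.
Proof.
split=> x; [apply: (etrans (dF_mF_ob _))
  |apply: (etrans (dF_mF_ar _))].
all: exact: (pbP (pr2 (pr2 x))).
Qed.
Fact alpha_one_eq :
  whiskL dF (whiskR alpha (q123 P)) ≡₂ whiskL cF (id2 (q4 P)).
Proof.
move=> x; apply: (etrans (d_alpha (fob (q123 P) x))).
apply: (etrans _ (esym (far_idn cF _))); apply: (congr1 idn).
exact: (pbP (pr2 (pr2 x))).
Qed.
Definition alpha_one :=
  pair2 alpha_one_src alpha_one_tgt (whiskR alpha (q123 P)) (id2 (q4 P))
    alpha_one_eq.

Fact one_alpha_src :
  dF ∘ q1 P ≡ cF ∘ (mF ∘ one_m P ∘ q234 P).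
Proof.
split=> x; [apply: (etrans _ (esym (cF_mF_ob _)))
  |apply: (etrans _ (esym (cF_mF_ar _)))].
all: exact: (pbP x).
Qed.
Fact one_alpha_tgt :
  dF ∘ q1 P ≡ cF ∘ (mF ∘ m_one P ∘ q234 P).
Proof.
split=> x; [do 2!apply: (etrans _ (esym (cF_mF_ob _)))
  |do 2!apply: (etrans _ (esym (cF_mF_ar _)))].
all: exact: (pbP x).
Qed.
Fact one_alpha_eq :
  whiskL dF (id2 (q1 P)) ≡₂
  whiskL cF (whiskR alpha (q234 P)).
Proof.
move=> x; apply: (etrans _ (esym (c_alpha (fob (q234 P) x)))).
apply: (etrans (far_idn dF _)); apply: (congr1 idn); exact: (pbP x).
Qed.
Definition one_alpha :=
  pair2 one_alpha_src one_alpha_tgt (id2 (q1 P)) (whiskR alpha (q234 P))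
    one_alpha_eq.

(* alpha(m x 1 x 1) . alpha(1 x 1 x m) *)
Fact pentagonL_eq :
  mF ∘ m_one P ∘ one_one_m P ≡ mF ∘ one_m P ∘ m_one_one P.
Proof.
split=> x; [apply: (congr1 (fob mF))|apply: (congr1 (far mF))].
all: apply: pb_eq; last by [].
- by apply: (congr1 (fob mF)); apply: pb_eq.
- by apply: (congr1 (far mF)); apply: pb_eq.
Qed.
Definition pentagonL :
  mF ∘ one_m P ∘ one_one_m P ⇒ mF ∘ m_one P ∘ m_one_one P :=
  vcomp (whiskR alpha (m_one_one P)) (whiskR alpha (one_one_m P)) pentagonL_eq.

(* m(alpha x 1) . alpha(1 x m x 1) . m(1 x alpha) *)
Fact pentagonR_eq1 :
  mF ∘ m_one P ∘ one_m_one P ≡ mF ∘ pairF _ _ alpha_one_src.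
Proof.
split=> x; [apply: (congr1 (fob mF))|apply: (congr1 (far mF))].
all: apply: pb_eq; last by [].
- by do 2!(apply: (congr1 (fob mF)); apply: pb_eq => //).
- by do 2!(apply: (congr1 (far mF)); apply: pb_eq => //).
Qed.
Fact pentagonR_eq2 :
  mF ∘ pairF _ _ one_alpha_tgt ≡ mF ∘ one_m P ∘ one_m_one P.
Proof.
split=> x; [apply: (congr1 (fob mF))|apply: (congr1 (far mF))].
all: by apply: pb_eq.
Qed.
Definition pentagonR :
  mF ∘ pairF _ _ one_alpha_src ⇒ mF ∘ pairF _ _ alpha_one_tgt :=
  vcomp (vcomp (whiskL mF alpha_one) (whiskR alpha (one_m_one P)) pentagonR_eq1)
    (whiskL mF one_alpha) pentagonR_eq2.

(* rho x 1 : (me1) x 1 ⇒ 1 and 1 x lambda : 1 x (me2) ⇒ 1, 2-cells between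
   functors from C2 to C2. *)
Fact rho_one_src :
  dF ∘ (mF ∘ e1 P ∘ s1 P) ≡ cF ∘ s2 P.
Proof.
split=> x; [apply: (etrans (dF_mF_ob _)); apply: (etrans (dF_eF_ob _))
  |apply: (etrans (dF_mF_ar _)); apply: (etrans (dF_eF_ar _))].
all: exact: (pbP x).
Qed.
Fact rho_one_tgt :
  dF ∘ (idF C1 ∘ s1 P) ≡ cF ∘ s2 P.
Proof.
by split=> x; exact: (pbP x).
Qed.
Fact rho_one_eq :
  whiskL dF (whiskR rho (s1 P)) ≡₂
  whiskL cF (id2 (s2 P)).
Proof.
move=> x; apply: (etrans (d_rho (fob (s1 P) x))).
apply: (etrans _ (esym (far_idn cF _))); apply: (congr1 idn); exact: (pbP x).
Qed.
Definition rho_one :=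
  pair2 rho_one_src rho_one_tgt (whiskR rho (s1 P)) (id2 (s2 P)) rho_one_eq.

Fact one_lam_src :
  dF ∘ s1 P ≡ cF ∘ (mF ∘ e2 P ∘ s2 P).
Proof.
split=> x.
- by apply: (etrans _ (esym (cF_mF_ob _))); apply: (etrans _ (esym (cF_eF_ob _)));
    exact: (pbP x).
- by apply: (etrans _ (esym (cF_mF_ar _))); apply: (etrans _ (esym (cF_eF_ar _)));
    exact: (pbP x).
Qed.
Fact one_lam_tgt :
  dF ∘ s1 P ≡ cF ∘ (idF C1 ∘ s2 P).
Proof.
by split=> x; exact: (pbP x).
Qed.
Fact one_lam_eq :
  whiskL dF (id2 (s1 P)) ≡₂
  whiskL cF (whiskR lam (s2 P)).
Proof.
move=> x; apply: (etrans _ (esym (c_lam (fob (s2 P) x)))).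
apply: (etrans (far_idn dF _)); apply: (congr1 idn); exact: (pbP x).
Qed.
Definition one_lam :=
  pair2 one_lam_src one_lam_tgt (id2 (s1 P)) (whiskR lam (s2 P)) one_lam_eq.

(* m(rho x 1) . alpha<pi1, e d pi1, pi2> *)
Fact triangle_eq :
  mF ∘ m_one P ∘ unit_mid P ≡ mF ∘ pairF _ _ rho_one_src.
Proof.
split=> x; [apply: (congr1 (fob mF))|apply: (congr1 (far mF))].
all: apply: pb_eq; last by [].
- by apply: (congr1 (fob mF)); apply: pb_eq.
- by apply: (congr1 (far mF)); apply: pb_eq.
Qed.
Definition triangleL :
  mF ∘ one_m P ∘ unit_mid P ⇒ mF ∘ pairF _ _ rho_one_tgt :=
  vcomp (whiskL mF rho_one) (whiskR alpha (unit_mid P)) triangle_eq.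

(* m(1 x lambda) *)
Definition triangleR :
  mF ∘ pairF _ _ one_lam_src ⇒ mF ∘ pairF _ _ one_lam_tgt :=
  whiskL mF one_lam.

End Coherence.

Record pseudocat := Pseudocat {
  pre :> preCat;
  alpha : mF ∘ one_m pre ⇒ mF ∘ m_one pre;
  lam : mF ∘ e2 pre ⇒ idF (C1 pre);
  rho : mF ∘ e1 pre ⇒ idF (C1 pre);
  alpha_inv : invertible alpha;
  lam_inv : invertible lam;
  rho_inv : invertible rho;
  d_lam : whiskL dF lam ≡₂ id2 dF;
  d_rho : whiskL dF rho ≡₂ id2 dF;
  c_lam : whiskL cF lam ≡₂ id2 cF;
  c_rho : whiskL cF rho ≡₂ id2 cF;
  d_alpha : whiskL dF alpha ≡₂ id2 (dF ∘ t3 pre);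
  c_alpha : whiskL cF alpha ≡₂ id2 (cF ∘ t1 pre);
  lam_e_rho_e : whiskR lam eF ≡₂ whiskR rho eF;
  pentagon : pentagonL alpha ≡₂ pentagonR d_alpha c_alpha;
  triangle : triangleL alpha d_rho ≡₂ triangleR c_lam
}.

Arguments alpha {p}.
Arguments lam {p}.
Arguments rho {p}.

Record intBicat := IntBicat {
  pseudo :> pseudocat;
  C0_discrete : discrete (C0 pseudo)
}.

(* 1_a ⊗ 1_a = 1_a: the 2-cells lambda e and rho e are the identity of e. *)
Definition unit_strict (C : pseudocat) : Prop :=
  (whiskR (@lam C) eF ≡₂ id2 eF) /\ (whiskR (@rho C) eF ≡₂ id2 eF).

Section Isomorphism.
Variables (C D : pseudocat).
Variables (F0 : functor (C0 C) (C0 D)) (F1 : functor (C1 C) (C1 D)).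
Hypothesis F_d : dF ∘ F1 ≡ F0 ∘ dF.
Hypothesis F_c : cF ∘ F1 ≡ F0 ∘ cF.

(* F1 x F1 : C2 -> D2 and F1 x F1 x F1 : C3 -> D3. *)
Fact map2_eq : dF ∘ (F1 ∘ s1 C) ≡ cF ∘ (F1 ∘ s2 C).
Proof.
split=> x.
- apply: (etrans (F_d.1 _)); apply: (etrans _ (esym (F_c.1 _))).
  by apply: (congr1 (fob F0)); exact: (pbP x).
- apply: (etrans (F_d.2 _)); apply: (etrans _ (esym (F_c.2 _))).
  by apply: (congr1 (far F0)); exact: (pbP x).
Qed.
Definition map2 : functor (C2 C) (C2 D) := pairF (F1 ∘ s1 C) (F1 ∘ s2 C) map2_eq.

Fact map3_eq : dF ∘ (F1 ∘ t1 C) ≡ cF ∘ s1 D ∘ (map2 ∘ t23 C).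
Proof.
split=> x.
- apply: (etrans (F_d.1 _)); apply: (etrans _ (esym (F_c.1 _))).
  by apply: (congr1 (fob F0)); exact: (pbP x).
- apply: (etrans (F_d.2 _)); apply: (etrans _ (esym (F_c.2 _))).
  by apply: (congr1 (far F0)); exact: (pbP x).
Qed.
Definition map3 : functor (C3 C) (C3 D) :=
  pairF (F1 ∘ t1 C) (map2 ∘ t23 C) map3_eq.

End Isomorphism.

Definition iso_functor (A B : intCat) (F : functor A B) : Prop :=
  bijective (fob F) /\ bijective (far F).

(* Isomorphisms of pseudocategories: invertible internal functors that preserve
   the whole structure on the nose. *)
Record isomorphism (C D : pseudocat) := Isomorphism {
  F0 : functor (C0 C) (C0 D);
  F1 : functor (C1 C) (C1 D);
  F0_iso : iso_functor F0;
  F1_iso : iso_functor F1;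
  F_d : dF ∘ F1 ≡ F0 ∘ dF;
  F_c : cF ∘ F1 ≡ F0 ∘ cF;
  F_e : F1 ∘ eF ≡ eF ∘ F0;
  F_m : F1 ∘ mF ≡ mF ∘ map2 F_d F_c;
  F_lam : whiskL F1 lam ≡₂ whiskR lam F1;
  F_rho : whiskL F1 rho ≡₂ whiskR rho F1;
  F_alpha : whiskL F1 alpha ≡₂ whiskR alpha (map3 F_d F_c)
}.

Definition isomorphic (C D : pseudocat) : Prop := inhabited (isomorphism C D).

(* The set G * H with the product (x, b)(x', b') = (x (b . x'), b b'), a group
   when H is a group and [xi] an action of H on G by homomorphisms. *)
Definition semidirect (G H : magmaType) (xi : H -> G -> G) : Type :=
  (G * H)%type.

Section Semidirect.
Variables (G H : magmaType) (xi : H -> G -> G).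

Definition semidirect_mul (p q : semidirect xi) : semidirect xi :=
  (p.1 * xi p.2 q.1, p.2 * q.2).

HB.instance Definition _ := hasMul.Build (semidirect xi) semidirect_mul.

End Semidirect.

Record bicatData := BicatData {
  X : groupType;
  B : groupType;
  hD : {hom X -> B};
  sD : {hom X -> X};
  tD : {hom X -> X};
  lamD : {hom X -> X};
  rhoD : {hom X -> X};
  act : B -> X -> X
}.

Section DataMaps.
Variable D : bicatData.
Local Notation X := (X D).
Local Notation B := (B D).
Local Notation h := (@hD D).
Local Notation s := (@sD D).
Local Notation t := (@tD D).
Local Notation l := (@lamD D).
Local Notation r := (@rhoD D).

Definition u (x : X) : X := s (r (t x)) * (r (t x))^-1 * r x.
Definition v (x : X) : X := s (l (t x)) * (l (t x))^-1 * l x.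

Definition alpha1 (x : X) : X :=
  s (r (r (t x))) * (r (s (r (t x))))^-1 * s (r (t x)) * (r (t x))^-1 * r x.

(* For an identity x, this is the inverse of rho(1 ⊗ x) after 1 ⊗ rho(x), as
   forced by coherence; for general x it is composed with 1 ⊗ (x ⊗ 1) = vu(x).
   The last three factors are v(rho x).  They cannot be replaced by those of
   [alpha1], that is by u(x): when lambda = id and (x, x') |-> x' on a codiscrete
   category G x G, the resulting map sends (a, b) to (1, b^-1). *)
Definition alpha2 (x : X) : X :=
  s (r (l (t x))) * (r (s (l (t x))))^-1 * s (l (t x)) * (l (t x))^-1 * l (r x).

Definition alpha3 (x : X) : X :=
  l (s (l (t x))) * (l (l (t x)))^-1 * l (l x).

Definition xi1 (p : semidirect (@act D)) (x : X) : X := act (h p.1 * p.2) x.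

Definition xi2 (p : semidirect xi1) (x : X) : X :=
  act (h (p.1 * p.2.1) * p.2.2) x.

(* The triple (x, x', b) is (x, (x', b)), and similarly for quadruples. *)
Definition mD (p : semidirect xi1) : semidirect (@act D) :=
  (u p.1 * v p.2.1, p.2.2).

Definition alphaD (p : semidirect xi2) : semidirect (@act D) :=
  (alpha1 p.1 * alpha2 p.2.1 * alpha3 p.2.2.1, p.2.2.2).

Record validData : Prop := ValidData {
  act1 : forall x : X, act (1 : B) x = x;
  actM : forall (b b' : B) (x : X), act (b * b') x = act b (act b' x);
  actD : forall (b : B) (x y : X), act b (x * y) = act b x * act b y;
  h_act : forall (b : B) (x : X), h (act b x) = b * h x * b^-1;
  s_t : forall x, s (t x) = t x;
  t_s : forall x, t (s x) = s x;
  h_s : forall x, h (s x) = h x;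
  h_t : forall x, h (t x) = h x;
  h_lam : forall x, h (l x) = h x;
  h_rho : forall x, h (r x) = h x;
  lam_norm : forall x, l x * (l (s x))^-1 * t (l (s x)) = x;
  rho_norm : forall x, r x * (r (s x))^-1 * t (r (s x)) = x;
  ker_comm : forall x y, s x = 1 -> t y = 1 -> x * y = y * x;
  mD_morph : {morph mD : p q / p * q};
  alphaD_morph : {morph alphaD : p q / p * q}
}.

(* [f0] and [f1] form an isomorphism from the pseudocategory C to the structure
   recovered from D: f0 identifies the objects of C0 with B and f1 the arrows of
   C1 with the semidirect product of X and B.  Objects of C1 are seen through
   their identity arrows.  The group of pairs (x, b) with s(x) = x and the
   structure on it are transported from C, so that nothing has to be assumed on
   D: the conditions of [validData] alone do not make s x 1 a homomorphism. *)
Record recovery (C : pseudocat) (f0 : {hom ob (C0 C) -> B})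
    (f1 : {multiplicative ar (C1 C) -> semidirect (@act D)}) : Prop := Recovery {
  f0_bij : bijective f0;
  f1_bij : bijective f1;
  f1_src : forall f, f1 (idn (src f)) = (s (f1 f).1, (f1 f).2);
  f1_tgt : forall f, f1 (idn (tgt f)) = (t (f1 f).1, (f1 f).2);
  f1_ob : forall p, (exists a, f1 (idn a) = p) <-> s p.1 = p.1;
  f1_cmp : forall p : pb (@src (C1 C)) tgt,
    f1 (cmp p) =
    ((f1 (pr1 p)).1 * (s (f1 (pr1 p)).1)^-1 * (f1 (pr2 p)).1, (f1 (pr2 p)).2);
  f1_d : forall f, f0 (src (far (@dF C) f)) = (f1 f).2;
  f1_c : forall f, f0 (src (far (@cF C) f)) = h (f1 f).1 * (f1 f).2;
  f1_e : forall b, f1 (idn (fob eF b)) = (1, f0 b);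
  f1_m : forall p : ar (C2 C),
    f1 (far mF p) = mD ((f1 (pr1 p)).1, f1 (pr2 p));
  f1_lam : forall a, f1 (lam a) = (l (f1 (idn a)).1, (f1 (idn a)).2);
  f1_rho : forall a, f1 (rho a) = (r (f1 (idn a)).1, (f1 (idn a)).2);
  f1_alpha : forall w : ob (C3 C),
    f1 (alpha w) = alphaD
      ((f1 (idn (fob (t1 C) w))).1,
       ((f1 (idn (fob (t2 C) w))).1, f1 (idn (fob (t3 C) w))))
}.

Definition recovered_from (C : intBicat) : Prop :=
  exists f0 f1, @recovery C f0 f1.

End DataMaps.

(* Main.v *)
From HB Require Import structures.
Require Import Defs.
From mathcomp Require Import all_boot.

(** In groups the composition of an internal category is forced: writing a
    composable pair as [(g, f) = (g, 1_x) (1, 1_x^-1 f)], with [x] the source of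
    [g], gives [g o f = g 1_x^-1 f] ([cmpE]).  Hence every equation between
    composites of 2-cells is an equation between elements of a group, and
    2-cells can always be cancelled.

    The object of objects [C0] is discrete, so it amounts to the group [B] of
    its arrows.  The homomorphism [d] from the arrows of [C1] to [B] is split by
    [e], so these arrows form a semidirect product of [X = ker d] and [B].  A
    natural transformation [s] from [F] to [F'] extends from objects to arrows,
    sending [f : a -> b] to the diagonal [F' f o s a = s b o F f] of its
    naturality square ([sweep]); this diagonal is multiplicative, and on [X] the
    ones of the unitors are the [lambda] and [rho] of the data.

    Because the unitors are trivial at identities, so is the associator, by the
    triangle.  A composable pair or triple is a product of tuples with at most
    one component that is not an identity, so [m] and the associator are
    determined by their values on these ([mE], [assocE]).
    - On pairs these values are [g @ 1] and [1 @ f], which naturality expresses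
      through [rho] and [lambda] ([unitR_formula], [unitL_formula]).
    - The associator at [(g, 1, 1)] and [(1, 1, k)] is given by the triangle
      ([triangle1], [triangle3]).
    - At [(1, f, 1)] it is given by the pentagon at [(1, f, 1, 1)]: naturality
      of the associator at [rho f] turns it into an equation all of whose terms
      are of the form [_ @ 1], and [_ @ 1] is faithful ([assoc2_ob]).  This is
      Kelly's proof that the triangle [rho o alpha = 1 @ rho] is redundant.

    The maps that the data require to be homomorphisms are then [m] and the
    associator read in coordinates ([data_valid]).  For uniqueness, a recovery
    writes each piece of structure as a formula in coordinates, so going through
    the coordinates of two bicategories recovered from the same data preserves
    the whole structure ([recovered_unique]). *)

Set Implicit Arguments.
Unset Strict Implicit.
Unset Printing Implicit Defensive.

Local Open Scope group_scope.

(* Left-associated normal form in a group, with inverses pushed to the atoms. *)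
Ltac group_nf :=
  rewrite ?(invgM, invgK, invg1, mulgA, mulgK, mulgVK, mulVg, mulgV, mul1g, mulg1).

(** * Kernels *)

Definition ker_pred (G H : groupType) (f : {hom G -> H}) : pred G :=
  fun x => f x == 1.

Section Kernel.
Variables (G H : groupType) (f : {hom G -> H}).

Record ker := Ker { ker_val :> G; ker_prop : ker_pred f ker_val }.

HB.instance Definition _ := [isSub for ker_val].
HB.instance Definition _ := [Choice of ker by <:].

Fact ker_closed : group_closed (ker_pred f).
Proof.
split=> [|x y /eqP fx /eqP fy]; apply/eqP; first exact: gmulf1.
by rewrite gmulfF fx fy mulgV.
Qed.

HB.instance Definition _ :=
  SubChoice_isSubGroup.Build G (ker_pred f) ker ker_closed.

Definition ker_incl : {hom ker -> G} := (val : ker -> G).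

Lemma kerP (x : ker) : f (ker_incl x) = 1.
Proof. exact/eqP/(ker_prop x). Qed.

Lemma ker_eq (x y : ker) : ker_incl x = ker_incl y -> x = y.
Proof. exact: val_inj. Qed.

End Kernel.

Arguments ker_incl {G H f}.

Section KernelEndo.
Variables (G H : groupType) (f : {hom G -> H}) (k : {hom G -> G}).
Hypothesis fk : forall x, f (k x) = f x.

Fact ker_endo_subproof (x : ker f) : ker_pred f (k (ker_incl x)).
Proof. by rewrite /ker_pred fk kerP. Qed.

Definition ker_endo_fun (x : ker f) : ker f := Ker (ker_endo_subproof x).

Fact ker_endo_morph : {morph ker_endo_fun : x y / x / y}.
Proof. by move=> x y; apply: val_inj; rewrite /= !gmulfF. Qed.

HB.instance Definition _ :=
  isGroupMorphism.Build (ker f) (ker f) ker_endo_fun ker_endo_morph.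

Definition ker_endo : {hom ker f -> ker f} := ker_endo_fun.

Lemma ker_endoE (x : ker f) : ker_incl (ker_endo x) = k (ker_incl x).
Proof. by []. Qed.

End KernelEndo.

(** * Internal categories in groups *)

Section InternalCategory.
Variable A : intCat.

(** Objects are handled through their identity arrows, so that everything takes
    place in the group of arrows. *)
Definition srcI : {hom ar A -> ar A} := compG idn src.
Definition tgtI : {hom ar A -> ar A} := compG idn tgt.

Lemma src_srcI f : src (srcI f) = src f. Proof. exact: src_idn. Qed.
Lemma tgt_srcI f : tgt (srcI f) = src f. Proof. exact: tgt_idn. Qed.
Lemma src_tgtI f : src (tgtI f) = tgt f. Proof. exact: src_idn. Qed.
Lemma tgt_tgtI f : tgt (tgtI f) = tgt f. Proof. exact: tgt_idn. Qed.

Lemma srcI_idn a : srcI (idn a) = idn a.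
Proof. by rewrite -[LHS]/(idn (src (idn a))) src_idn. Qed.
Lemma srcI_tgtI f : srcI (tgtI f) = tgtI f.
Proof. by rewrite -[LHS]/(idn (src (tgtI f))) src_tgtI. Qed.
Lemma tgtI_srcI f : tgtI (srcI f) = srcI f.
Proof. by rewrite -[LHS]/(idn (tgt (srcI f))) tgt_srcI. Qed.

(** The pair [p = (g, f)] is the product of [(g, 1_x)] and [(1, 1_x^-1 f)], with
    [x] the source of [g]; composition is multiplicative and unital. *)
Lemma cmpE (p : pb (@src A) tgt) :
  cmp p = pr1 p * (srcI (pr1 p))^-1 * pr2 p.
Proof.
set g := pr1 p; set f := pr2 p; have gf : src g = tgt f := pbP p.
have e1 : src g = tgt (srcI g) by rewrite tgt_srcI.
have e2 : src (1 : ar A) = tgt ((srcI g)^-1 * f).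
  by rewrite gmulf1 gmulfM gmulfV tgt_srcI -gf mulVg.
have -> : p = pbk g (srcI g) e1 * pbk 1 ((srcI g)^-1 * f) e2.
  apply: pb_eq; rewrite gmulfM; apply/esym; first exact: mulg1.
  exact: mulVKg.
rewrite gmulfM -mulgA; congr (_ * _).
- by rewrite -[RHS]cmpf1; apply: cmp_eq.
- rewrite -[RHS]cmp1f; apply: cmp_eq => //.
  by rewrite -e2 !gmulf1.
Qed.

Lemma cmp_pbk (g f : ar A) e : cmp (pbk g f e) = g * (srcI g)^-1 * f.
Proof. exact: cmpE. Qed.

(** The composite of such [x] and [y] is [x * y]; by the interchange law it is
    also the product of the composites of [(1, y)] and [(x, 1)], that is [y * x]. *)
Lemma ker_src_tgt_commute (x y : ar A) :
  src x = 1 -> tgt y = 1 -> x * y = y * x.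
Proof.
move=> sx ty.
have e : src x = tgt y by rewrite sx ty.
have e1 : src (1 : ar A) = tgt y by rewrite ty gmulf1.
have e2 : src x = tgt (1 : ar A) by rewrite sx gmulf1.
have s1 z : src z = 1 -> srcI z = 1 by move=> z1; rewrite /= z1 gmulf1.
have -> : x * y = cmp (pbk x y e) by rewrite cmp_pbk s1 // invg1 mulg1.
have -> : pbk x y e = pbk 1 y e1 * pbk x 1 e2.
  by apply: pb_eq; rewrite gmulfM; apply/esym; [exact: mul1g|exact: mulg1].
by rewrite gmulfM !cmp_pbk !s1 ?gmulf1 // invg1 !mulg1 mul1g.
Qed.

End InternalCategory.

Arguments srcI {A}.
Arguments tgtI {A}.

(** * Natural transformations as homomorphisms on arrows *)

Section Functors.
Variables (A B : intCat) (F : functor A B).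

Lemma far_srcI f : far F (srcI f) = srcI (far F f).
Proof. by rewrite /= far_idn src_far. Qed.
Lemma far_tgtI f : far F (tgtI f) = tgtI (far F f).
Proof. by rewrite /= far_idn tgt_far. Qed.
Lemma fobE a : fob F a = src (far F (idn a)).
Proof. by rewrite far_idn src_idn. Qed.

End Functors.

(** Objects embed into arrows by identities. *)
Lemma eqF_far (A B : intCat) (F G : functor A B) : far F =1 far G -> F ≡ G.
Proof. by move=> e; split=> // a; rewrite !fobE e. Qed.

Section Sweep.
Variables (A B : intCat) (F G : functor A B) (s : F ⇒ G).

Fact sweep_composable f : src (far G f) = tgt (s (src f)).
Proof. by rewrite src_far tgt_nt. Qed.

Definition sweep_pair : {hom ar A -> pb (@src B) tgt} :=
  pairG (a := far G) (b := compG s src) sweep_composable.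

(** The diagonal of the naturality square of [s] at an arrow. *)
Definition sweep : {hom ar A -> ar B} := compG cmp sweep_pair.

Lemma sweepE f : sweep f = far G f * (far G (srcI f))^-1 * s (src f).
Proof. by rewrite /sweep -[LHS]/(cmp _) cmpE far_srcI. Qed.

Lemma sweep_idn a : sweep (idn a) = s a.
Proof. by rewrite sweepE /= src_idn mulgV mul1g. Qed.

(** The two ways around the naturality square, composed by [cmpE]. *)
Lemma sweep_src f : sweep f = far G f * (far G (srcI f))^-1 * sweep (srcI f).
Proof. by rewrite sweepE sweep_idn. Qed.

Lemma sweep_tgt f : sweep f = sweep (tgtI f) * (far F (tgtI f))^-1 * far F f.
Proof.
rewrite sweep_idn far_idn -(src_nt s).
rewrite -[X in _ * X^-1]/(srcI (s (tgt f))) -cmp_pbk.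
  exact: etrans (src_nt s _) (esym (tgt_far F f)).
by move=> e; apply/esym; exact: naturalE.
Qed.

Lemma srcI_sweep f : srcI (sweep f) = far F (srcI f).
Proof.
rewrite far_idn; apply: (congr1 idn).
exact: etrans (src_cmp (sweep_pair f)) (src_nt s (src f)).
Qed.

Lemma tgtI_sweep f : tgtI (sweep f) = far G (tgtI f).
Proof.
rewrite far_idn; apply: (congr1 idn).
exact: etrans (tgt_cmp (sweep_pair f)) (tgt_far G f).
Qed.

End Sweep.

Lemma vcompE (A B : intCat) (F G G' H : functor A B)
  (s' : G' ⇒ H) (s : F ⇒ G) e a :
  vcomp s' s e a = s' a * (srcI (s' a))^-1 * s a.
Proof. exact: cmpE (pairG (vcomp_composable s' s e) a). Qed.

(** * Tensoring with identities *)

Section Bicategory.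
Variable C : intBicat.
Hypothesis strict : unit_strict C.

Local Notation G := (ar (C1 C)).
Local Notation B := (ar (C0 C)).
Local Notation d := (far (@dF C)).
Local Notation c := (far (@cF C)).
Local Notation e := (far (@eF C)).
Local Notation m := (far (@mF C)).

Lemma srcI_discrete (b : B) : srcI b = b.
Proof. exact/esym/(C0_discrete b). Qed.

Lemma tgtI_discrete (b : B) : tgtI b = b.
Proof.
by rewrite -[in LHS](srcI_discrete b) tgtI_srcI srcI_discrete.
Qed.

Lemma d_srcI (g : G) : d (srcI g) = d g.
Proof. by rewrite far_srcI srcI_discrete. Qed.
Lemma d_tgtI (g : G) : d (tgtI g) = d g.
Proof. by rewrite far_tgtI tgtI_discrete. Qed.
Lemma c_srcI (g : G) : c (srcI g) = c g.
Proof. by rewrite far_srcI srcI_discrete. Qed.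
Lemma c_tgtI (g : G) : c (tgtI g) = c g.
Proof. by rewrite far_tgtI tgtI_discrete. Qed.
Lemma srcI_e (b : B) : srcI (e b) = e b.
Proof. by rewrite -far_srcI srcI_discrete. Qed.
Lemma tgtI_e (b : B) : tgtI (e b) = e b.
Proof. by rewrite -far_tgtI tgtI_discrete. Qed.

Lemma d_sweep A (F F' : functor A (C1 C)) (s : F ⇒ F') f :
  d (sweep s f) = d (far F f).
Proof. by rewrite -d_srcI srcI_sweep far_srcI d_srcI. Qed.

Lemma c_sweep A (F F' : functor A (C1 C)) (s : F ⇒ F') f :
  c (sweep s f) = c (far F f).
Proof. by rewrite -c_srcI srcI_sweep far_srcI c_srcI. Qed.

(** [unitR g = g @ 1] and [unitL f = 1 @ f]; [rhoA] and [lamA] are the unitors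
    extended to all arrows. *)
Definition unitR : {hom G -> G} := far (mF ∘ e1 C).
Definition unitL : {hom G -> G} := far (mF ∘ e2 C).
Definition rhoA : {hom G -> G} := sweep (@rho C).
Definition lamA : {hom G -> G} := sweep (@lam C).

Lemma d_e b : d (e b) = b. Proof. exact: dF_eF_ar. Qed.
Lemma c_e b : c (e b) = b. Proof. exact: cF_eF_ar. Qed.

Lemma d_unitR g : d (unitR g) = d g.
Proof. by apply: etrans (dF_mF_ar _) _; exact: d_e. Qed.
Lemma c_unitR g : c (unitR g) = c g.
Proof. exact: cF_mF_ar. Qed.
Lemma d_unitL g : d (unitL g) = d g.
Proof. exact: dF_mF_ar. Qed.
Lemma c_unitL g : c (unitL g) = c g.
Proof. by apply: etrans (cF_mF_ar _) _; exact: c_e. Qed.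

Lemma d_rhoA g : d (rhoA g) = d g.
Proof. by rewrite d_sweep -/unitR d_unitR. Qed.
Lemma c_rhoA g : c (rhoA g) = c g.
Proof. by rewrite c_sweep -/unitR c_unitR. Qed.
Lemma d_lamA g : d (lamA g) = d g.
Proof. by rewrite d_sweep -/unitL d_unitL. Qed.
Lemma c_lamA g : c (lamA g) = c g.
Proof. by rewrite c_sweep -/unitL c_unitL. Qed.

Lemma srcI_rhoA g : srcI (rhoA g) = unitR (srcI g).
Proof. exact: srcI_sweep. Qed.
Lemma tgtI_rhoA g : tgtI (rhoA g) = tgtI g.
Proof. exact: tgtI_sweep. Qed.
Lemma srcI_lamA g : srcI (lamA g) = unitL (srcI g).
Proof. exact: srcI_sweep. Qed.
Lemma tgtI_lamA g : tgtI (lamA g) = tgtI g.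
Proof. exact: tgtI_sweep. Qed.

Lemma rhoA_src g : rhoA g = g * (srcI g)^-1 * rhoA (srcI g).
Proof. exact: sweep_src. Qed.
Lemma rhoA_tgt g : rhoA g = rhoA (tgtI g) * (unitR (tgtI g))^-1 * unitR g.
Proof. exact: sweep_tgt. Qed.
Lemma lamA_src g : lamA g = g * (srcI g)^-1 * lamA (srcI g).
Proof. exact: sweep_src. Qed.
Lemma lamA_tgt g : lamA g = lamA (tgtI g) * (unitL (tgtI g))^-1 * unitL g.
Proof. exact: sweep_tgt. Qed.

Lemma srcI_unitR g : srcI (unitR g) = unitR (srcI g).
Proof. by rewrite /unitR -far_srcI. Qed.
Lemma srcI_unitL g : srcI (unitL g) = unitL (srcI g).
Proof. by rewrite /unitL -far_srcI. Qed.
Lemma tgtI_unitL g : tgtI (unitL g) = unitL (tgtI g).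
Proof. by rewrite /unitL -far_tgtI. Qed.

Lemma e_idn (b : B) : e b = idn (fob eF (src b)).
Proof. by rewrite -far_idn -[idn (src b)]/(srcI b) srcI_discrete. Qed.

(** The condition [1_a @ 1_a = 1_a] enters the proof here and in [lamA_e]. *)
Lemma rhoA_e b : rhoA (e b) = e b.
Proof. by rewrite e_idn /rhoA sweep_idn; exact: strict.2. Qed.
Lemma lamA_e b : lamA (e b) = e b.
Proof. by rewrite e_idn /lamA sweep_idn; exact: strict.1. Qed.

Lemma unitR_e b : unitR (e b) = e b.
Proof. by rewrite -[in LHS]srcI_e -srcI_rhoA rhoA_e srcI_e. Qed.
Lemma unitL_e b : unitL (e b) = e b.
Proof. by rewrite -[in LHS]srcI_e -srcI_lamA lamA_e srcI_e. Qed.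

(** Naturality of [rho] conjugates [g @ 1] into [g]. *)
Lemma unitR_inj g f :
  srcI g = srcI f -> tgtI g = tgtI f -> unitR g = unitR f -> g = f.
Proof.
move=> sgf tgf ugf; have : rhoA g = rhoA f by rewrite (rhoA_tgt g) (rhoA_tgt f) ugf tgf.
by rewrite (rhoA_src g) (rhoA_src f) sgf => /mulIg /mulIg.
Qed.

Lemma unitRE g E : m (pbk g (e (d g)) E) = unitR g.
Proof. by apply: (congr1 m); apply: pb_eq. Qed.
Lemma unitLE f E : m (pbk (e (c f)) f E) = unitL f.
Proof. by apply: (congr1 m); apply: pb_eq. Qed.

(** The pair [(g, f)] is the product of [(g, 1)], the inverse of [(1, 1)] and
    [(1, f)], where [1] stands for the identity arrow of the identity morphism
    of the object between [g] and [f], and [1 @ 1 = 1]. *)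
Lemma mE g f E : m (pbk g f E) = unitR g * (e (d g))^-1 * unitL f.
Proof.
have E1 : d g = c (e (d g)) by rewrite c_e.
have E2 : d (e (d g)) = c (e (d g)) by rewrite d_e c_e.
have E3 : d (e (c f)) = c f by rewrite d_e.
have E4 : d (e (c (e (d g)))) = c (e (d g)) by rewrite d_e.
have mee : m (pbk (e (d g)) (e (d g)) E2) = e (d g).
  rewrite -[RHS]unitL_e -(unitLE E4).
  by apply: (congr1 m); apply: pb_eq => //=; rewrite c_e.
rewrite -(unitRE E1) -(unitLE E3) -[X in _ * X^-1 * _]mee -gmulfV -!gmulfM.
apply: (congr1 m).
by apply: pb_eq; rewrite !gmulfM gmulfV /= ?E; group_nf.
Qed.

(** * The associator *)

Definition assocA : {hom ar (C3 C) -> G} := sweep (@alpha C).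

(** The functors sending [g] to [(g, 1, 1)], to [(1, g, 1)] and to [(1, 1, g)].
    The first and the third pass through [(g, 1)] and [(1, g)], in which
    [unit_mid] inserts an identity: this is the form in which the triangle
    applies. *)
Definition slot1 : functor (C1 C) (C3 C) := unit_mid C ∘ e1 C.
Fact slot2_eq : dF ∘ (eF ∘ cF) ≡ cF ∘ s1 C ∘ e1 C.
Proof. by apply: eqF_far => f; exact: d_e. Qed.
Definition slot2 : functor (C1 C) (C3 C) := pairF (eF ∘ cF) (e1 C) slot2_eq.
Definition slot3 : functor (C1 C) (C3 C) := unit_mid C ∘ e2 C.

Definition assoc1 : {hom G -> G} := sweep (whiskR alpha slot1).
Definition assoc2 : {hom G -> G} := sweep (whiskR alpha slot2).
Definition assoc3 : {hom G -> G} := sweep (whiskR alpha slot3).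

Lemma sweep_whiskR (A A' A'' : intCat) (F F' : functor A' A'') (s : F ⇒ F')
  (K : functor A A') f : sweep (whiskR s K) f = sweep s (far K f).
Proof. by rewrite !sweepE /= far_idn src_far. Qed.

Lemma assoc1E g : assoc1 g = assocA (far slot1 g). Proof. exact: sweep_whiskR. Qed.
Lemma assoc2E g : assoc2 g = assocA (far slot2 g). Proof. exact: sweep_whiskR. Qed.
Lemma assoc3E g : assoc3 g = assocA (far slot3 g). Proof. exact: sweep_whiskR. Qed.

Lemma tripleE (w : ar (C3 C))
    (g : G := pr1 w) (f : G := pr1 (pr2 w)) (k : G := pr2 (pr2 w)) :
  w = far slot1 g * (far slot1 (e (d g)))^-1 * far slot2 f
      * (far slot2 (e (d f)))^-1 * far slot3 k.
Proof.
have E1 : d g = c f := pbP w; have E2 : d f = c k := pbP (pr2 w).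
apply: pb_eq; last apply: pb_eq.
all: rewrite !(gmulfM, gmulfV).
- by rewrite -[LHS]/g /= !c_e E1 E2; group_nf.
- by rewrite -[LHS]/f /= !d_e -E2 E1; group_nf.
- by rewrite -[LHS]/k /= !d_e; group_nf.
Qed.

(** The triangle at [(g, f)], for [g] and [f] identity arrows; [x] is the arrow
    [rho_g @ f]. *)
Lemma triangleE (W : ar (C2 C)) (g : G := pr1 W) (f : G := pr2 W)
    (x : G := unitR (rhoA g) * (e (d g))^-1 * unitL f) :
  W = srcI W ->
  x * (srcI x)^-1 * assocA (far (unit_mid C) W) =
  unitR g * (e (d g))^-1 * unitL (lamA f).
Proof.
move=> WE; have gE : g = srcI g by rewrite {1}/g WE.
have fE : f = srcI f by rewrite {1}/f WE.
have rE : rho (src g) = rhoA g by rewrite [in RHS]gE [RHS]sweep_idn.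
have lE : lam (src f) = lamA f by rewrite [in RHS]fE [RHS]sweep_idn.
have E1 : d (rhoA g) = c f by rewrite d_rhoA; exact: pbP W.
have E2 : d g = c (lamA f) by rewrite c_lamA; exact: pbP W.
have <- : whiskL mF (rho_one (@d_rho C)) (src W) = x.
  rewrite /x -d_rhoA -(mE E1); apply: (congr1 m).
  by apply: pb_eq; [exact: rE|rewrite [RHS]fE].
have -> : assocA (far (unit_mid C) W) = whiskR alpha (unit_mid C) (src W).
  by rewrite [in LHS]WE far_idn; exact: sweep_idn.
have := @triangle C (src W); rewrite /triangleL vcompE => ->.
rewrite -(mE E2); apply: (congr1 m).
by apply: pb_eq; [rewrite [RHS]gE|exact: lE].
Qed.

(** The triangle at [(g, 1)], where the right-hand side [1 @ lambda_1] is an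
    identity. *)
Lemma triangle1 g : g = srcI g ->
  unitR (rhoA g) * (unitR (unitR g))^-1 * assoc1 g = unitR g.
Proof.
move=> gE; have W : far (e1 C) g = srcI (far (e1 C) g) by rewrite -far_srcI -gE.
have T : let x := unitR (rhoA g) * (e (d g))^-1 * unitL (e (d g)) in
  x * (srcI x)^-1 * assocA (far (unit_mid C) (far (e1 C) g)) =
  unitR g * (e (d g))^-1 * unitL (lamA (e (d g))) := triangleE W.
move: T; cbv zeta; rewrite lamA_e unitL_e !mulgVK => T; rewrite -[RHS]T.
by rewrite srcI_unitR srcI_rhoA -gE assoc1E.
Qed.

(** The triangle at [(1, k)], where [rho_1 @ k] is an identity. *)
Lemma triangle3 k : k = srcI k -> assoc3 k = unitL (lamA k).
Proof.
move=> kE; have W : far (e2 C) k = srcI (far (e2 C) k) by rewrite -far_srcI -kE.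
have T : let x := unitR (rhoA (e (c k))) * (e (d (e (c k))))^-1 * unitL k in
  x * (srcI x)^-1 * assocA (far (unit_mid C) (far (e2 C) k)) =
  unitR (e (c k)) * (e (d (e (c k))))^-1 * unitL (lamA k) := triangleE W.
move: T; cbv zeta; rewrite rhoA_e unitR_e d_e mulgV !mul1g => T; rewrite -[RHS]T.
by rewrite srcI_unitL -kE mulgV mul1g assoc3E.
Qed.

Lemma assoc1_e b : assoc1 (e b) = e b.
Proof.
have := triangle1 (esym (srcI_e b)).
by rewrite rhoA_e !unitR_e mulgV mul1g.
Qed.
Lemma assoc2_e b : assoc2 (e b) = e b.
Proof.
rewrite -[RHS]assoc1_e assoc1E assoc2E; apply: (congr1 assocA).
by apply: pb_eq; [rewrite /= c_e|apply: pb_eq; rewrite /= ?d_e].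
Qed.
Lemma assoc3_e b : assoc3 (e b) = e b.
Proof. by rewrite (triangle3 (esym (srcI_e b))) lamA_e unitL_e. Qed.

Lemma assocE (w : ar (C3 C)) g f k :
  pr1 w = g -> pr1 (pr2 w) = f -> pr2 (pr2 w) = k ->
  assocA w = assoc1 g * (e (d g))^-1 * assoc2 f * (e (d f))^-1 * assoc3 k.
Proof.
move=> <- <- <-; rewrite [in LHS](tripleE w) !(gmulfM, gmulfV).
rewrite -!assoc1E -!assoc2E -assoc3E.
by rewrite assoc1_e assoc2_e.
Qed.

Lemma one_mE (w : ar (C3 C)) g f k :
  pr1 w = g -> pr1 (pr2 w) = f -> pr2 (pr2 w) = k ->
  far (mF ∘ one_m C) w =
  unitR g * (e (d g))^-1 * unitL (unitR f * (e (d f))^-1 * unitL k).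
Proof.
move=> wg wf wk.
have E1 : d f = c k by rewrite -wf -wk; exact: pbP (pr2 w).
have E2 : d g = c (m (pbk f k E1))
  by rewrite cF_mF_ar -wg; apply: etrans (pbP w) _; rewrite -[RHS]/(c f) -wf.
rewrite -(mE E1) -(mE E2); apply: (congr1 m); apply: pb_eq; first exact: wg.
by apply: (congr1 m); apply: pb_eq; [exact: wf|exact: wk].
Qed.

Lemma m_oneE (w : ar (C3 C)) g f k :
  pr1 w = g -> pr1 (pr2 w) = f -> pr2 (pr2 w) = k ->
  far (mF ∘ m_one C) w =
  unitR (unitR g * (e (d g))^-1 * unitL f) * (e (d f))^-1 * unitL k.
Proof.
move=> wg wf wk.
have E1 : d g = c f by rewrite -wf -wg; exact: pbP w.
have E2 : d (m (pbk g f E1)) = c k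
  by rewrite dF_mF_ar -wk -[LHS]/(d f) -wf; exact: pbP (pr2 w).
rewrite -(mE E1) -[d f](dF_mF_ar (pbk g f E1)) -(mE E2).
apply: (congr1 m); apply: pb_eq; last exact: wk.
by apply: (congr1 m); apply: pb_eq; [exact: wg|exact: wf].
Qed.

Lemma one_m_slot1 g : far (mF ∘ one_m C ∘ slot1) g = unitR g.
Proof.
rewrite [LHS](@one_mE _ g (e (d g)) (e (d g))) //.
by rewrite unitR_e unitL_e d_e mulgV mul1g unitL_e mulgVK.
Qed.



Lemma one_m_slot2 f : far (mF ∘ one_m C ∘ slot2) f = unitL (unitR f).
Proof.
rewrite [LHS](@one_mE _ (e (c f)) f (e (d f))) //.
by rewrite unitR_e unitL_e d_e; group_nf.
Qed.

Lemma m_one_slot2 f : far (mF ∘ m_one C ∘ slot2) f = unitR (unitL f).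
Proof.
rewrite [LHS](@m_oneE _ (e (c f)) f (e (d f))) //.
by rewrite unitR_e unitL_e d_e; group_nf.
Qed.

Lemma one_m_slot3 k : far (mF ∘ one_m C ∘ slot3) k = unitL (unitL k).
Proof.
rewrite [LHS](@one_mE _ (e (c k)) (e (c k)) k) //; last by rewrite /= d_e.
by rewrite unitR_e d_e; group_nf.
Qed.


Lemma assoc1_tgt g : assoc1 g = assoc1 (tgtI g) * (unitR (tgtI g))^-1 * unitR g.
Proof. by rewrite [LHS]sweep_tgt !one_m_slot1. Qed.

Lemma assoc2_tgt f : assoc2 f =
  assoc2 (tgtI f) * (unitL (unitR (tgtI f)))^-1 * unitL (unitR f).
Proof. by rewrite [LHS]sweep_tgt !one_m_slot2. Qed.

Lemma assoc2_src f : assoc2 f =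
  unitR (unitL f) * (unitR (unitL (srcI f)))^-1 * assoc2 (srcI f).
Proof. by rewrite [LHS]sweep_src !m_one_slot2. Qed.

Lemma assoc3_tgt k : assoc3 k =
  assoc3 (tgtI k) * (unitL (unitL (tgtI k)))^-1 * unitL (unitL k).
Proof. by rewrite [LHS]sweep_tgt !one_m_slot3. Qed.

Lemma srcI_assoc1 g : srcI (assoc1 g) = unitR (srcI g).
Proof. by rewrite [LHS]srcI_sweep one_m_slot1. Qed.
Lemma srcI_assoc2 f : srcI (assoc2 f) = unitL (unitR (srcI f)).
Proof. by rewrite [LHS]srcI_sweep one_m_slot2. Qed.
Lemma tgtI_assoc2 f : tgtI (assoc2 f) = unitR (unitL (tgtI f)).
Proof. by rewrite [LHS]tgtI_sweep m_one_slot2. Qed.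

Lemma c_assoc1 g : c (assoc1 g) = c g.
Proof. by rewrite c_sweep one_m_slot1 c_unitR. Qed.
Lemma d_assoc2 f : d (assoc2 f) = d f.
Proof. by rewrite d_sweep one_m_slot2 d_unitL d_unitR. Qed.

(** The functor sending [f] to [(1, f, 1, 1)]. *)
Fact slot2of4_eq : dF ∘ (eF ∘ cF) ≡ cF ∘ t1 C ∘ slot1.
Proof. by apply: eqF_far => f; exact: d_e. Qed.
Definition slot2of4 : functor (C1 C) (C4 C) := pairF (eF ∘ cF) slot1 slot2of4_eq.

Lemma alpha_assocA (K : functor (C1 C) (C3 C)) x :
  x = srcI x -> alpha (fob K (src x)) = assocA (far K x).
Proof.
move=> xE; rewrite -[LHS](sweep_idn (@alpha C)) -far_idn.
by rewrite -[idn (src x)]/(srcI x) -xE.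
Qed.

Lemma far_m_one_one_slot2of4 x :
  far (m_one_one C) (far slot2of4 x) = far slot1 (unitL x).
Proof.
apply: pb_eq; last apply: pb_eq.
- by apply: (congr1 m); apply: pb_eq.
- by rewrite -[RHS]/(e (d (unitL x))) d_unitL.
- by rewrite -[RHS]/(e (d (unitL x))) d_unitL.
Qed.

Lemma far_one_one_m_slot2of4 x :
  far (one_one_m C) (far slot2of4 x) = far slot2 x.
Proof.
apply: pb_eq => //; apply: pb_eq => //.
have E : d (e (d x)) = c (e (d x)) by rewrite d_e c_e.
transitivity (m (pbk (e (d x)) (e (d x)) E)); first by apply: (congr1 m); apply: pb_eq.
by rewrite mE unitR_e unitL_e d_e mulgV mul1g.
Qed.

Lemma far_q123_slot2of4 x : far (q123 C) (far slot2of4 x) = far slot2 x.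
Proof. by apply: pb_eq => //; apply: pb_eq. Qed.

Lemma far_q234_slot2of4 x : far (q234 C) (far slot2of4 x) = far slot1 x.
Proof. by []. Qed.

Lemma far_one_m_one_slot2of4 x :
  far (one_m_one C) (far slot2of4 x) = far slot2 (unitR x).
Proof.
apply: pb_eq; last apply: pb_eq.
- by rewrite -[RHS]/(e (c (unitR x))) c_unitR.
- by apply: (congr1 m); apply: pb_eq.
- by rewrite -[RHS]/(e (d (unitR x))) d_unitR.
Qed.

(** The pentagon at [(1, x, 1, 1)].  Its five sides are the associators at
    [(1 @ x, 1, 1)] and [(1, x, 1)], then the one at [(1, x, 1)] tensored with 1
    on the right, the one at [(1, x @ 1, 1)], and the one at [(x, 1, 1)] tensored
    with 1 on the left. *)
Lemma pentagon2 x : x = srcI x ->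
  assoc1 (unitL x) * (unitR (unitL x))^-1 * assoc2 x =
  unitR (assoc2 x) * (unitR (unitL (unitR x)))^-1 * assoc2 (unitR x)
    * (unitL (unitR (unitR x)))^-1 * unitL (assoc1 x).
Proof.
move=> xE; pose w := fob slot2of4 (src x).
have A1 : whiskR alpha (m_one_one C) w = assoc1 (unitL x).
  by rewrite assoc1E -far_m_one_one_slot2of4 -(alpha_assocA (m_one_one C ∘ slot2of4)).
have A2 : whiskR alpha (one_one_m C) w = assoc2 x.
  by rewrite assoc2E -far_one_one_m_slot2of4 -(alpha_assocA (one_one_m C ∘ slot2of4)).
have A3 : whiskR alpha (one_m_one C) w = assoc2 (unitR x).
  by rewrite assoc2E -far_one_m_one_slot2of4 -(alpha_assocA (one_m_one C ∘ slot2of4)).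
have A4 : whiskR alpha (q123 C) w = assoc2 x.
  by rewrite assoc2E -far_q123_slot2of4 -(alpha_assocA (q123 C ∘ slot2of4)).
have A5 : whiskR alpha (q234 C) w = assoc1 x.
  by rewrite assoc1E -far_q234_slot2of4 -(alpha_assocA (q234 C ∘ slot2of4)).
have A6 : whiskL mF (alpha_one (@d_alpha C)) w = unitR (assoc2 x).
  apply: (congr1 m); apply: pb_eq; first exact: A4.
  rewrite -[RHS]/(e (d (assoc2 x))) d_assoc2 [in RHS]xE !far_idn.
  by [].
have A7 : whiskL mF (one_alpha (@c_alpha C)) w = unitL (assoc1 x).
  apply: (congr1 m); apply: pb_eq; last exact: A5.
  by rewrite -[RHS]/(e (c (assoc1 x))) c_assoc1 [in RHS]xE !far_idn.
have := @pentagon C w; rewrite /pentagonL /pentagonR !vcompE.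
rewrite A1 A2 A3 A6 A7.
have S1 : srcI (assoc1 (unitL x)) = unitR (unitL x).
  by rewrite srcI_assoc1 srcI_unitL -xE.
have S2 : srcI (unitR (assoc2 x)) = unitR (unitL (unitR x)).
  by rewrite srcI_unitR srcI_assoc2 -xE.
have S3 : srcI (unitR (unitL (unitR x))) = unitR (unitL (unitR x)).
  by rewrite srcI_unitR srcI_unitL srcI_unitR -xE.
have S4 : srcI (assoc2 (unitR x)) = unitL (unitR (unitR x)).
  by rewrite srcI_assoc2 srcI_unitR -xE.
by rewrite S1 gmulfM gmulfF S2 S3 S4 mulgV mul1g.
Qed.

Lemma tgtI_of_srcI (x : G) : x = srcI x -> tgtI x = x.
Proof. by move->; rewrite tgtI_srcI. Qed.

(** Naturality of [rho] at the arrow [rho_x], where [rho_x] can be cancelled. *)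
Lemma rhoA_unitR x : x = srcI x -> rhoA (unitR x) = unitR (rhoA x).
Proof.
move=> xE; have := rhoA_src (rhoA x); rewrite {1}rhoA_tgt.
by rewrite srcI_rhoA tgtI_rhoA -xE (tgtI_of_srcI xE) => /mulgI.
Qed.

Lemma lamA_unitL x : x = srcI x -> lamA (unitL x) = unitL (lamA x).
Proof.
move=> xE; have := lamA_src (lamA x); rewrite {1}lamA_tgt.
by rewrite srcI_lamA tgtI_lamA -xE (tgtI_of_srcI xE) => /mulgI.
Qed.

Lemma assoc1_ob x : x = srcI x ->
  assoc1 x = unitR (unitR x) * (unitR (rhoA x))^-1 * unitR x.
Proof. by move=> /triangle1 T; rewrite -[in X in _ = _ * X]T; group_nf. Qed.

(** The triangle [rho_(1 @ x) o alpha_(1, x, 1) = 1 @ rho_x], solved for the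
    associator.  Both sides have the same source and target, so it is enough to
    compare them after applying [_ @ 1]. *)
Lemma assoc2_ob x : x = srcI x ->
  assoc2 x = unitR (unitL x) * (rhoA (unitL x))^-1 * unitL (rhoA x).
Proof.
move=> xE; have xT := tgtI_of_srcI xE.
have vE : unitL x = srcI (unitL x) by rewrite srcI_unitL -xE.
have uvE : unitR (unitL x) = srcI (unitR (unitL x)) by rewrite srcI_unitR -vE.
apply: unitR_inj.
- rewrite srcI_assoc2 !gmulfM gmulfV -uvE srcI_rhoA -vE srcI_unitL srcI_rhoA.
  by rewrite -xE mulgV mul1g.
- rewrite tgtI_assoc2 !gmulfM gmulfV (tgtI_of_srcI uvE) tgtI_rhoA.
  by rewrite (tgtI_of_srcI vE) tgtI_unitL tgtI_rhoA xT mulgVK.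
(* Naturality of the associator at [(1, rho_x, 1)] expresses its component at
   [(1, x @ 1, 1)] by the one at [(1, x, 1)], which then cancels in the
   pentagon. *)
have := pentagon2 xE.
have := etrans (esym (assoc2_tgt (rhoA x))) (assoc2_src (rhoA x)).
rewrite tgtI_rhoA srcI_rhoA xT -xE => N.
have {}N : assoc2 (unitR x) = unitR (unitL (unitR x)) * (unitR (unitL (rhoA x)))^-1
    * (assoc2 x * (unitL (unitR x))^-1 * unitL (unitR (rhoA x))).
  by rewrite N; group_nf.
rewrite (assoc1_ob vE) (assoc1_ob xE) N !gmulfM !gmulfV mulgK; group_nf.
by move=> /mulIg ->; rewrite mulgVK.
Qed.

(** * The formulas of the data *)

Lemma unitR_formula g : unitR g =
  srcI (rhoA (tgtI g)) * (rhoA (tgtI g))^-1 * rhoA g.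
Proof.
by rewrite srcI_rhoA srcI_tgtI (rhoA_tgt g); group_nf.
Qed.

Lemma unitL_formula g : unitL g =
  srcI (lamA (tgtI g)) * (lamA (tgtI g))^-1 * lamA g.
Proof.
by rewrite srcI_lamA srcI_tgtI (lamA_tgt g); group_nf.
Qed.

(** An arrow [g] is brought back to its target by naturality, and the target is
    covered by the formulas for identity arrows. *)
Lemma assoc1_formula g : assoc1 g =
  srcI (rhoA (rhoA (tgtI g))) * (rhoA (srcI (rhoA (tgtI g))))^-1
  * srcI (rhoA (tgtI g)) * (rhoA (tgtI g))^-1 * rhoA g.
Proof.
have tE := esym (srcI_tgtI g).
rewrite assoc1_tgt (assoc1_ob tE) !srcI_rhoA -tE (rhoA_unitR tE).
by rewrite (rhoA_tgt g); group_nf.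
Qed.

Lemma assoc2_formula g : assoc2 g =
  srcI (rhoA (lamA (tgtI g))) * (rhoA (srcI (lamA (tgtI g))))^-1
  * srcI (lamA (tgtI g)) * (lamA (tgtI g))^-1 * lamA (rhoA g).
Proof.
have tE := esym (srcI_tgtI g).
rewrite assoc2_tgt (assoc2_ob tE) srcI_rhoA srcI_lamA -tE.
rewrite (lamA_tgt (rhoA g)) tgtI_rhoA (rhoA_tgt g) !gmulfM !gmulfV.
by group_nf.
Qed.

Lemma assoc3_formula g : assoc3 g =
  lamA (srcI (lamA (tgtI g))) * (lamA (lamA (tgtI g)))^-1 * lamA (lamA g).
Proof.
have tE := esym (srcI_tgtI g).
rewrite assoc3_tgt (triangle3 tE) srcI_lamA -tE -(lamA_unitL tE).
rewrite (lamA_tgt g) !gmulfM !gmulfV (lamA_tgt (unitL g)) tgtI_unitL.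
by group_nf.
Qed.

(** * The data of an internal bicategory *)

Local Notation K := (ker d).

Fact conj_e_ker (b : B) (x : K) : ker_pred d (e b * ker_incl x * (e b)^-1).
Proof.
have kx : d (ker_incl x) = 1 := kerP x.
by apply/eqP; rewrite gmulfM gmulfV gmulfM !d_e kx mulg1 mulgV.
Qed.

Definition conj_e (b : B) (x : K) : K := Ker (conj_e_ker b x).

Definition data : bicatData :=
  @BicatData K B (compG c ker_incl) (ker_endo d_srcI) (ker_endo d_tgtI)
    (ker_endo d_lamA) (ker_endo d_rhoA) conj_e.

Local Notation S := (semidirect (@act data)).
Local Notation S1 := (semidirect (@xi1 data)).
Local Notation S2 := (semidirect (@xi2 data)).

Fact ker_part_subproof (g : G) : ker_pred d (g * (e (d g))^-1).
Proof. by apply/eqP; rewrite gmulfM gmulfV d_e mulgV. Qed.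

Definition ker_part (g : G) : K := Ker (ker_part_subproof g).

Definition arrow_coord (g : G) : S := (ker_part g, d g).

Fact arrow_coord_morph : {morph arrow_coord : g f / g * f}.
Proof.
move=> g f; congr pair; last exact: gmulfM.
by apply: ker_eq; rewrite !gmulfM /= !gmulfM; group_nf.
Qed.

HB.instance Definition _ :=
  isMultiplicative.Build G S arrow_coord arrow_coord_morph.

Definition arrow_of (p : S) : G := ker_incl (p.1 : K) * e p.2.

Lemma d_arrow_of (p : S) : d (arrow_of p) = p.2.
Proof.
by rewrite gmulfM d_e -[RHS]mul1g; congr (_ * _); exact: kerP.
Qed.

Lemma arrow_ofK : cancel arrow_of arrow_coord.
Proof.
case=> x b; congr pair; last exact: d_arrow_of.
by apply: ker_eq; rewrite -[LHS]/(arrow_of (x, b) * _) d_arrow_of; exact: mulgK.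
Qed.

Lemma arrow_coordK : cancel arrow_coord arrow_of.
Proof. by move=> g; exact: mulgVK. Qed.

Lemma arrow_of_morph : {morph arrow_of : p q / p * q}.
Proof.
by move=> [x b] [y b']; rewrite /arrow_of /= !gmulfM /=; group_nf.
Qed.

Lemma c_arrow_of (p : S) : c (arrow_of p) = hD data p.1 * p.2.
Proof. by rewrite gmulfM c_e. Qed.

Lemma incl_u (x : K) : ker_incl (u (x : X data)) = unitR (ker_incl x).
Proof. by rewrite unitR_formula !gmulfM gmulfV. Qed.
Lemma incl_v (x : K) : ker_incl (v (x : X data)) = unitL (ker_incl x).
Proof. by rewrite unitL_formula !gmulfM gmulfV. Qed.
Lemma incl_alpha1 (x : K) : ker_incl (alpha1 (x : X data)) = assoc1 (ker_incl x).
Proof. by rewrite assoc1_formula !gmulfM !gmulfV. Qed.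
Lemma incl_alpha2 (x : K) : ker_incl (alpha2 (x : X data)) = assoc2 (ker_incl x).
Proof. by rewrite assoc2_formula !gmulfM !gmulfV. Qed.
Lemma incl_alpha3 (x : K) : ker_incl (alpha3 (x : X data)) = assoc3 (ker_incl x).
Proof. by rewrite assoc3_formula !gmulfM !gmulfV. Qed.

Lemma incl_ker_part g : ker_incl (ker_part g) = g * (e (d g))^-1.
Proof. by []. Qed.

Lemma arrow_coord_m (w : ar (C2 C)) :
  arrow_coord (m w) = @mD data (ker_part (pr1 w), arrow_coord (pr2 w)).
Proof.
have E : d (pr1 w) = c (pr2 w) := pbP w.
have -> : w = pbk (pr1 w) (pr2 w) E by apply: pb_eq.
congr pair; last by rewrite dF_mF_ar.
apply: ker_eq; rewrite gmulfM incl_u incl_v !incl_ker_part dF_mF_ar mE.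
by rewrite !gmulfM !gmulfV unitR_e unitL_e; group_nf.
Qed.

Lemma arrow_coord_assocA (w : ar (C3 C)) :
  arrow_coord (assocA w) =
  @alphaD data (ker_part (pr1 w), (ker_part (pr1 (pr2 w)), arrow_coord (pr2 (pr2 w)))).
Proof.
have dw : d (assocA w) = d (pr2 (pr2 w)).
  by rewrite d_sweep; apply: etrans (dF_mF_ar _) _; exact: dF_mF_ar.
congr pair; last exact: dw.
apply: ker_eq; rewrite gmulfM gmulfM incl_alpha1 incl_alpha2 incl_alpha3.
rewrite !incl_ker_part dw (assocE (w := w) erefl erefl erefl).
by rewrite !gmulfM !gmulfV assoc1_e assoc2_e assoc3_e; group_nf.
Qed.

Lemma ker_part_arrow_of x b : ker_part (arrow_of (x, b)) = x.
Proof. exact: (congr1 fst (arrow_ofK (x, b))). Qed.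

Lemma c_arrow_ofM p q : c (arrow_of (p * q)) = c (arrow_of p) * c (arrow_of q).
Proof. by rewrite arrow_of_morph gmulfM. Qed.

Fact pair_of_eq (p : S1) :
  d (arrow_of (p.1, c (arrow_of p.2))) = c (arrow_of p.2).
Proof. exact: d_arrow_of. Qed.

(** The composable pair [((x, h(x')b), (x', b))]; note that [h(x')b] is the
    value of [c] at [(x', b)]. *)
Definition pair_of (p : S1) : ar (C2 C) := pbk _ _ (pair_of_eq p).

Lemma pair_of_morph : {morph pair_of : p q / p * q}.
Proof.
move=> p q; apply: pb_eq; last exact: arrow_of_morph.
rewrite gmulfM -[RHS]arrow_of_morph; apply: (congr1 arrow_of).
congr pair; last exact: c_arrow_ofM.
by rewrite /= c_arrow_of.
Qed.

Lemma mD_pair_of p : mD p = arrow_coord (m (pair_of p)).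
Proof.
case: p => x p; rewrite arrow_coord_m; apply/esym/(congr1 (@mD data)).
by congr pair; [exact: ker_part_arrow_of|exact: arrow_ofK].
Qed.

Fact triple_of_eq (p : S2) :
  d (arrow_of (p.1, c (arrow_of (p.2.1, c (arrow_of p.2.2))))) =
  far (cF ∘ s1 C) (pair_of p.2).
Proof. exact: d_arrow_of. Qed.

Definition triple_of (p : S2) : ar (C3 C) := pbk _ _ (triple_of_eq p).

Lemma triple_of_morph : {morph triple_of : p q / p * q}.
Proof.
move=> p q; apply: pb_eq; last exact: pair_of_morph.
rewrite gmulfM -[RHS]arrow_of_morph; apply: (congr1 arrow_of).
congr pair; last first.
  have E : c (pr1 (pair_of (p.2 * q.2))) =
           c (pr1 (pair_of p.2)) * c (pr1 (pair_of q.2)).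
    by rewrite pair_of_morph !gmulfM.
  exact: E.
by rewrite /= /xi2 !c_arrow_of gmulfM -mulgA.
Qed.

Lemma alphaD_triple_of p : alphaD p = arrow_coord (assocA (triple_of p)).
Proof.
case: p => x [x' p]; rewrite arrow_coord_assocA; apply/esym/(congr1 (@alphaD data)).
congr pair; first exact: ker_part_arrow_of.
by congr pair; [exact: ker_part_arrow_of|exact: arrow_ofK].
Qed.

Lemma hD_conj_e (b : B) (x : K) : hD data (conj_e b x) = b * hD data x * b^-1.
Proof.
rewrite -[LHS]/(c (e b * ker_incl x * (e b)^-1)).
by rewrite gmulfM gmulfV gmulfM !c_e.
Qed.

Lemma lamA_norm g : lamA g * (lamA (srcI g))^-1 * tgtI (lamA (srcI g)) = g.
Proof. by rewrite tgtI_lamA tgtI_srcI (lamA_src g); group_nf. Qed.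

Lemma rhoA_norm g : rhoA g * (rhoA (srcI g))^-1 * tgtI (rhoA (srcI g)) = g.
Proof. by rewrite tgtI_rhoA tgtI_srcI (rhoA_src g); group_nf. Qed.

Lemma srcI_eq1 (g : G) : srcI g = 1 -> src g = 1.
Proof. by move=> g1; rewrite -src_srcI g1 gmulf1. Qed.
Lemma tgtI_eq1 (g : G) : tgtI g = 1 -> tgt g = 1.
Proof. by move=> g1; rewrite -tgt_tgtI g1 gmulf1. Qed.

(** * Validity and recovery *)

Lemma data_valid : validData data.
Proof.
split.
- by move=> x; apply: ker_eq; rewrite /= !gmulf1; group_nf.
- by move=> b b' x; apply: ker_eq; rewrite /= gmulfM; group_nf.
- by move=> b x y; apply: ker_eq; rewrite /=; group_nf.
- exact: hD_conj_e.
- by move=> x; apply: ker_eq; exact: srcI_tgtI.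
- by move=> x; apply: ker_eq; exact: tgtI_srcI.
- by move=> x; exact: c_srcI.
- by move=> x; exact: c_tgtI.
- by move=> x; exact: c_lamA.
- by move=> x; exact: c_rhoA.
- by move=> x; apply: ker_eq; rewrite !gmulfM gmulfV; exact: lamA_norm.
- by move=> x; apply: ker_eq; rewrite !gmulfM gmulfV; exact: rhoA_norm.
- move=> x y /(congr1 ker_incl) sx /(congr1 ker_incl) ty; apply: ker_eq.
  by rewrite !gmulfM; apply: ker_src_tgt_commute; [exact: srcI_eq1|exact: tgtI_eq1].
- by move=> p q; rewrite !mD_pair_of pair_of_morph !gmulfM.
- by move=> p q; rewrite !alphaD_triple_of triple_of_morph !gmulfM.
Qed.

Lemma arrow_coord_e b : arrow_coord (e b) = (1, b).
Proof.
by congr pair; [apply: ker_eq; rewrite incl_ker_part d_e gmulf1 mulgV|exact: d_e].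
Qed.

Lemma arrow_coord_cmp (p : pb (@src (C1 C)) tgt) :
  arrow_coord (cmp p) =
  (ker_part (pr1 p) * (ker_endo d_srcI (ker_part (pr1 p)))^-1 * ker_part (pr2 p),
   d (pr2 p)).
Proof.
have dp : d (pr1 p) = d (pr2 p).
  by rewrite -d_srcI -[in RHS]d_tgtI; apply: (congr1 (d \o idn)); exact: pbP p.
rewrite cmpE; congr pair; last by rewrite !gmulfM gmulfV d_srcI mulgV mul1g.
apply: ker_eq; rewrite [RHS]gmulfM [X in _ = X * _]gmulfM gmulfV ker_endoE.
rewrite !incl_ker_part !gmulfM !gmulfV d_srcI srcI_e dp.
by group_nf; rewrite dp.
Qed.

Lemma data_recovered : recovered_from data C.
Proof.
have kE (k : {hom G -> G}) (dk : forall g, d (k g) = d g) g :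
    (forall b, k (e b) = e b) ->
    arrow_coord (k g) = (ker_endo dk (ker_part g), d g) :> S.
  move=> ke; congr pair; last exact: dk.
  by apply: ker_eq; rewrite /= gmulfM gmulfV ke dk.
exists idn, arrow_coord; split.
- by exists src => [a|b]; [exact: src_idn|exact: srcI_discrete].
- by exists arrow_of; [exact: arrow_coordK|exact: arrow_ofK].
- by move=> g; exact: (kE srcI d_srcI g srcI_e).
- by move=> g; exact: (kE tgtI d_tgtI g tgtI_e).
- case=> x b; split=> [[a [xE _]]|sx].
    have /(congr1 fst) := kE srcI d_srcI (idn a) srcI_e.
    by rewrite srcI_idn /= xE => /esym.
  exists (src (arrow_of (x, b))).
  apply: etrans (kE srcI d_srcI (arrow_of (x, b)) srcI_e) _.
  by rewrite ker_part_arrow_of d_arrow_of; congr pair.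
- exact: arrow_coord_cmp.
- by move=> g; exact: srcI_discrete.
- move=> g; rewrite -c_arrow_of arrow_coordK; exact: srcI_discrete.
- by move=> b; rewrite -far_idn; exact: arrow_coord_e.
- exact: arrow_coord_m.
- by move=> a; rewrite -(kE lamA d_lamA (idn a) lamA_e) [lamA _]sweep_idn.
- by move=> a; rewrite -(kE rhoA d_rhoA (idn a) rhoA_e) [rhoA _]sweep_idn.
- move=> w; rewrite -[alpha w](sweep_idn (@alpha C)).
  exact: arrow_coord_assocA (idn w).
Qed.

End Bicategory.

(** * Bicategories recovered from the same data *)

Section Uniqueness.
Variables (D : bicatData) (C C' : intBicat).
Variables (f0 : {hom ob (C0 C) -> B D}) (f0' : {hom ob (C0 C') -> B D}).
Variable f1 : {multiplicative ar (C1 C) -> semidirect (@act D)}.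
Variable f1' : {multiplicative ar (C1 C') -> semidirect (@act D)}.
Hypotheses (rec : recovery f0 f1) (rec' : recovery f0' f1').
Variables (g0' : B D -> ob (C0 C')) (g1' : semidirect (@act D) -> ar (C1 C')).
Hypotheses (f0'K : cancel f0' g0') (g0'K : cancel g0' f0').
Hypotheses (f1'K : cancel f1' g1') (g1'K : cancel g1' f1').

Lemma idn_inj (A : intCat) : injective (@idn A).
Proof. exact: can_inj (@src_idn A). Qed.

Let f0'_inj : injective f0' := can_inj f0'K.
Let f1'_inj : injective f1' := can_inj f1'K.

(** The comparison functors are determined by having the same coordinates on
    both sides ([compare0K], [compare1K]); each preservation statement follows
    by applying the injective coordinate map of [C']. *)
Definition compare0_fun (b : ob (C0 C)) : ob (C0 C') := g0' (f0 b).

Lemma compare0K b : f0' (compare0_fun b) = f0 b. Proof. exact: g0'K. Qed.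

Fact compare0_morph : {morph compare0_fun : a b / a / b}.
Proof. by move=> a b; apply: f0'_inj; rewrite gmulfF !compare0K gmulfF. Qed.

HB.instance Definition _ :=
  isGroupMorphism.Build (ob (C0 C)) (ob (C0 C')) compare0_fun compare0_morph.

Definition compare1_fun (g : ar (C1 C)) : ar (C1 C') := g1' (f1 g).

Lemma compare1K g : f1' (compare1_fun g) = f1 g. Proof. exact: g1'K. Qed.

Fact compare1M : {morph compare1_fun : g f / g * f}.
Proof. by move=> g f; apply: f1'_inj; rewrite gmulfM !compare1K gmulfM. Qed.

Fact compare1_morph : {morph compare1_fun : g f / g / f}.
Proof.
by move=> g f; apply: (mulIg (compare1_fun f)); rewrite mulgVK -compare1M mulgVK.
Qed.

HB.instance Definition _ :=
  isGroupMorphism.Build (ar (C1 C)) (ar (C1 C')) compare1_fun compare1_morph.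

Definition compare0_ob : {hom ob (C0 C) -> ob (C0 C')} := compare0_fun.
Definition compare1_ar : {hom ar (C1 C) -> ar (C1 C')} := compare1_fun.
Definition compare0_ar : {hom ar (C0 C) -> ar (C0 C')} :=
  compG idn (compG compare0_ob src).
Definition compare1_ob : {hom ob (C1 C) -> ob (C1 C')} :=
  compG src (compG compare1_ar idn).

Lemma tgt_discrete (A : intBicat) (b : ar (C0 A)) : tgt b = src b.
Proof. by rewrite [in LHS](C0_discrete b) tgt_idn. Qed.

Fact compare0_cmp (p : pb (@src (C0 C)) tgt) E :
  compare0_ar (cmp p) =
  cmp (pbk (compare0_ar (pr1 p)) (compare0_ar (pr2 p)) E).
Proof.
rewrite [RHS](C0_discrete _) src_cmp.
by apply: (congr1 idn); rewrite /= src_idn src_cmp.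
Qed.

Definition compare0 : functor (C0 C) (C0 C').
Proof.
refine (@Functor _ _ compare0_ob compare0_ar _ _ _ (fun p => compare0_cmp _)).
- by move=> b; exact: src_idn.
- by move=> b; rewrite tgt_discrete [RHS](congr1 _ (tgt_discrete b)); exact: src_idn.
- by move=> b; apply: (congr1 idn); rewrite /= src_idn.
Defined.

(** Coordinates detect identity arrows: they are the values of [f1_src]. *)
Lemma idn_compare1_ob a : idn (compare1_ob a) = compare1_ar (idn a).
Proof.
apply: f1'_inj; rewrite (f1_src rec') compare1K.
by rewrite -[in RHS](src_idn a) (f1_src rec).
Qed.

Fact compare1_src f : src (compare1_ar f) = compare1_ob (src f).
Proof.
apply: idn_inj; rewrite idn_compare1_ob; apply: f1'_inj.
by rewrite (f1_src rec') !compare1K (f1_src rec).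
Qed.

Fact compare1_tgt f : tgt (compare1_ar f) = compare1_ob (tgt f).
Proof.
apply: idn_inj; rewrite idn_compare1_ob; apply: f1'_inj.
by rewrite (f1_tgt rec') !compare1K (f1_tgt rec).
Qed.

Fact compare1_cmp (p : pb (@src (C1 C)) tgt) E :
  compare1_ar (cmp p) =
  cmp (pbk (compare1_ar (pr1 p)) (compare1_ar (pr2 p)) E).
Proof.
apply: f1'_inj; rewrite compare1K (f1_cmp rec) (f1_cmp rec').
by rewrite -(compare1K (pr1 p)) -(compare1K (pr2 p)).
Qed.

Definition compare1 : functor (C1 C) (C1 C') :=
  Functor (src_far := compare1_src) (tgt_far := compare1_tgt)
    (fun a => esym (idn_compare1_ob a)) (fun p => compare1_cmp _).

Lemma compare0_iso : iso_functor compare0.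
Proof.
have [g0 f0K g0K] := f0_bij rec.
have K b : g0 (f0' (compare0_ob b)) = b by rewrite compare0K f0K.
have K' b : compare0_ob (g0 (f0' b)) = b.
  by apply: f0'_inj; rewrite compare0K g0K.
split; first by exists (g0 \o f0').
exists (idn \o g0 \o f0' \o src) => b.
  by rewrite [RHS](C0_discrete b); apply: (congr1 idn); rewrite /= src_idn K.
by rewrite [RHS](C0_discrete b); apply: (congr1 idn); rewrite /= src_idn K'.
Qed.

Lemma compare1_iso : iso_functor compare1.
Proof.
have [g1 f1K g1K] := f1_bij rec.
have K g : g1 (f1' (compare1_ar g)) = g by rewrite compare1K f1K.
have K' g : compare1_ar (g1 (f1' g)) = g.
  by apply: f1'_inj; rewrite compare1K g1K.
split; last by exists (g1 \o f1').
exists (src \o g1 \o f1' \o idn) => a /=.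
  by rewrite -[idn (src _)]/(idn (compare1_ob a)) idn_compare1_ob K src_idn.
by rewrite -[LHS]/(compare1_ob (src _)) -compare1_src K' src_idn.
Qed.

Lemma compare_d : dF ∘ compare1 ≡ compare0 ∘ dF.
Proof.
apply: eqF_far => g; rewrite [LHS](C0_discrete _); apply: (congr1 idn).
by apply: f0'_inj; rewrite (f1_d rec') compare1K compare0K (f1_d rec).
Qed.

Lemma compare_c : cF ∘ compare1 ≡ compare0 ∘ cF.
Proof.
apply: eqF_far => g; rewrite [LHS](C0_discrete _); apply: (congr1 idn).
by apply: f0'_inj; rewrite (f1_c rec') compare1K compare0K (f1_c rec).
Qed.

Lemma compare_e : compare1 ∘ eF ≡ eF ∘ compare0.
Proof.
apply: eqF_far => b; apply: f1'_inj; apply: etrans (compare1K _) _.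
rewrite [far eF b]e_idn (f1_e rec); apply/esym.
by rewrite [far (eF ∘ compare0) b]e_idn (f1_e rec') /= src_idn compare0K.
Qed.

Lemma compare_m : compare1 ∘ mF ≡ mF ∘ map2 compare_d compare_c.
Proof.
apply: eqF_far => p; apply: f1'_inj; apply: etrans (compare1K _) _.
set q := far (map2 compare_d compare_c) p.
have K1 : f1' (pr1 q) = f1 (pr1 p) := compare1K (pr1 p).
have K2 : f1' (pr2 q) = f1 (pr2 p) := compare1K (pr2 p).
by rewrite [LHS](f1_m rec) -K1 -K2; apply/esym; exact: (f1_m rec' q).
Qed.

Lemma compare_lam : whiskL compare1 lam ≡₂ whiskR lam compare1.
Proof.
move=> a; apply: f1'_inj; apply: etrans (compare1K _) _.
by rewrite (f1_lam rec) (f1_lam rec') idn_compare1_ob compare1K.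
Qed.

Lemma compare_rho : whiskL compare1 rho ≡₂ whiskR rho compare1.
Proof.
move=> a; apply: f1'_inj; apply: etrans (compare1K _) _.
by rewrite (f1_rho rec) (f1_rho rec') idn_compare1_ob compare1K.
Qed.

Lemma compare_alpha :
  whiskL compare1 alpha ≡₂ whiskR alpha (map3 compare_d compare_c).
Proof.
move=> w; apply: f1'_inj; apply: etrans (compare1K _) _.
have K a : f1 (idn a) = f1' (idn (compare1_ob a)).
  by rewrite idn_compare1_ob compare1K.
apply: etrans (f1_alpha rec w) _.
apply: etrans _ (esym (f1_alpha rec' (fob (map3 compare_d compare_c) w))).
apply: (congr1 (@alphaD D)); congr pair; last congr pair.
- exact: (congr1 fst (K (fob (t1 C) w))).
- exact: (congr1 fst (K (fob (t2 C) w))).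
- exact: (K (fob (t3 C) w)).
Qed.

Definition compare : isomorphism C C' :=
  Isomorphism compare0_iso compare1_iso compare_e compare_m
    compare_lam compare_rho compare_alpha.

End Uniqueness.

Theorem recovered_unique (D : bicatData) (C C' : intBicat) :
  recovered_from D C -> recovered_from D C' -> isomorphic C C'.
Proof.
move=> [f0 [f1 rec]] [f0' [f1' rec']].
have [g0' f0'K g0'K] := f0_bij rec'; have [g1' f1'K g1'K] := f1_bij rec'.
by split; exact: (compare rec rec' f0'K g0'K f1'K g1'K).
Qed.

Theorem mainTheorem1 :
  forall C : intBicat, unit_strict C ->
  exists D : bicatData,
    validData D /\
    recovered_from D C /\
    (forall C' : intBicat,
       unit_strict C' -> recovered_from D C' -> isomorphic C C').
Proof.
move=> C strict; exists (data C); split; first exact: data_valid.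
split=> [|C' _ rec']; first exact: data_recovered.
by apply: recovered_unique rec'; exact: data_recovered.
Qed.
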